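(* Let $\mathcal H$ be a real Hilbert space, let $A\colon\mathcal H\to 2^{\mathcal H}$ be maximally monotone, let $\alpha\in\left]0,+\infty\right[$, let $\beta\in\left]0,+\infty\right[$, let $B\colon\mathcal H\to\mathcal H$ be $\beta$-cocoercive, let $(\eta_n)_{n\in\mathbb N}\in\ell_+^1(\mathbb N)$, and let $(U_n)_{n\in\mathbb N}$ be a sequence in $\mathcal P_\alpha(\mathcal H)$ such that $$\mu=\sup_{n\in\mathbb N}\|U_n\|<+\infty\quad\text{and}\quad(\forall n\in\mathbb N)\quad(1+\eta_n)U_{n+1}\succcurlyeq U_n.$$ Let $\varepsilon\in\left]0,\min\{1,2\beta/(\mu+1)\}\right]$, let $(\lambda_n)_{n\in\mathbb N}$ be a sequence in $[\varepsilon,1]$, let $(\gamma_n)_{n\in\mathbb N}$ be a sequence in $[\varepsilon,(2\beta-\varepsilon)/\mu]$, let $x_0\in\mathcal H$, and let $(a_n)_{n\in\mathbb N}$ and $(b_n)_{n\in\mathbb N}$ be absolutely summable sequences in $\mathcal H$. Suppose that $Z=\operatorname{zer}(A+B)\neq\varnothing$, and set, for every $n\in\mathbb N$, $$y_n=x_n-\gamma_nU_n(Bx_n+b_n),\qquad x_{n+1}=x_n+\lambda_n\big(J_{\gamma_nU_nA}(y_n)+a_n-x_n\big).$$ Then the following hold for some $\overline x\in Z$. (i) $x_n\rightharpoonup\overline x$ (weak convergence). (ii) $\sum_{n\in\mathbb N}\|Bx_n-B\overline x\|^2<+\infty$. (iii) Suppose that one of the following holds: (a) $\varliminf_{n\to+\infty}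 d_Z(x_n)=0$. (b) At every point in $Z$, $A$ or $B$ is demiregular. (c) $\operatorname{int}Z\neq\varnothing$ and there exists $(\nu_n)_{n\in\mathbb N}\in\ell_+^1(\mathbb N)$ such that $(\forall n\in\mathbb N)$ $(1+\nu_n)U_n\succcurlyeq U_{n+1}$. Then $x_n\to\overline x$ (strong convergence).
   Context: For a real Hilbert space $\mathcal H$ with scalar product $\langle\cdot\mid\cdot\rangle$ and norm $\|\cdot\|$: - For bounded self-adjoint linear operators $U,V$ on $\mathcal H$, $U\succcurlyeq V$ means $\langle Ux\mid x\rangle\geq\langle Vx\mid x\rangle$ for every $x\in\mathcal H$. For $\alpha\in[0,+\infty[$, $\mathcal P_\alpha(\mathcal H)$ is the set of bounded self-adjoint linear operators $U$ on $\mathcal H$ such that $U\succcurlyeq\alpha\,\mathrm{Id}$. - $\ell_+^1(\mathbb N)$ is the set of summable sequences in $[0,+\infty[$. A sequence $(a_n)$ in $\mathcal H$ is absolutely summable if $\sum_n\|a_n\|<+\infty$. - A set-valued operator $A\colon\mathcal H\to2^{\mathcal H}$ has graph $\operatorname{gra}A=\{(x,u)\mid u\in Ax\}$, domain $\operatorname{dom}A=\{x\mid Ax\neq\varnothing\}$, and set of zeros $\operatorname{zer}A=\{x\mid 0\in Ax\}$. It is monotone if $\langle x-y\mid u-v\rangle\geq0$ for all $(x,u),(y,v)\in\operatorname{gra}A$, and maximally monotone if moreover its graph is not properly contained in the graph of another monotone operator. The resolvent of $A$ is $J_A=(\mathrm{Id}+A)^{-1}$, where the inverse is that of set-valued operators;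 the resolvents $J_{\gamma_nU_nA}$ in the claim are single-valued and defined on all of $\mathcal H$, where $\gamma_nU_nA\colon x\mapsto\{\gamma_nU_nu\mid u\in Ax\}$. - $B\colon\mathcal H\to\mathcal H$ is $\beta$-cocoercive if $\langle x-y\mid Bx-By\rangle\geq\beta\|Bx-By\|^2$ for all $x,y\in\mathcal H$. - $d_Z(x)=\inf_{y\in Z}\|x-y\|$, and $\operatorname{int}Z$ is the interior of $Z$. - $A\colon\mathcal H\to2^{\mathcal H}$ is demiregular at $x\in\operatorname{dom}A$ if, for every sequence $((x_n,u_n))_{n\in\mathbb N}$ in $\operatorname{gra}A$ and every $u\in Ax$ such that $x_n\rightharpoonup x$ (weakly) and $u_n\to u$ (strongly), we have $x_n\to x$ (strongly). *)

(* Defs.v *)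
From HB Require Import structures.
From mathcomp Require Import all_boot all_order all_algebra.
From mathcomp Require Import all_classical all_reals all_analysis.
Import Order.TTheory GRing.Theory Num.Theory.
Import numFieldNormedType.Exports.

Set Implicit Arguments.
Unset Strict Implicit.
Unset Printing Implicit Defensive.

Local Open Scope classical_set_scope.
Local Open Scope ring_scope.

Section Sequences.
Context {R : realType}.

Definition l1_plus (u : R^nat) : Prop :=
  (forall n, 0 <= u n) /\ cvgn (series u).

Definition absolutely_summable {V : normedModType R} (a : V^nat) : Prop :=
  cvgn [normed series a].

End Sequences.

Section SetValuedOperators.
Context {R : realType} {H : normedModType R}.
Implicit Types (A T : H -> set H) (B : H -> H).

Definition gra A : set (H * H) := [set xu | A xu.1 xu.2].
Definition dom A : set H := [set x | A x !=set0].
Definition zer A : set H := [set x | A x 0].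

Definition op_inv T : H -> set H := fun u => [set x | T x u].
Definition op_add A T : H -> set H :=
  fun x => [set u + v | u in A x & v in T x].
Definition op_comp B A : H -> set H := fun x => B @` A x.
Definition op_fun B : H -> set H := fun x => [set B x].

Definition resolvent A : H -> set H := op_inv (op_add (op_fun idfun) A).

(* The point of [resolvent A y] when this set is a singleton; the value is 0 if
   the set is empty, which does not happen for the operators gamma U A with A
   maximally monotone, U in P_alpha, alpha > 0 and gamma > 0. *)
Definition J A (y : H) : H := xget 0 (resolvent A y).

Definition dist_to (Z : set H) (x : H) : R := inf [set `|x - y| | y in Z].

Definition opnorm (U : H -> H) : R :=
  sup [set `|U x| | x in [set x | `|x| <= 1]].

End SetValuedOperators.

(* A real Hilbert space is a complete normed module H together with a symmetric
   positive definite bilinear form inducing its norm. *)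
Definition hilbert_product {R : realType} {H : completeNormedModType R}
  (dot : {dot H for (@idfun R)}) : Prop :=
  forall x : H, dot x x = `|x| ^+ 2.

Section HilbertSpace.
Context {R : realType} {H : completeNormedModType R}.
Variable dot : {dot H for (@idfun R)}.
Implicit Types (A : H -> set H) (B : H -> H).

Definition loewner_ge (U V : H -> H) : Prop :=
  forall x, dot (U x) x >= dot (V x) x.

Definition P_ (alpha : R) (U : {linear H -> H}) : Prop :=
  [/\ exists M : R, forall x, `|U x| <= M * `|x|,
      forall x y, dot (U x) y = dot x (U y) &
      loewner_ge U (fun x => alpha *: x)].

Definition monotone_op A : Prop :=
  forall x u y v, gra A (x, u) -> gra A (y, v) -> 0 <= dot (x - y) (u - v).

Definition maximally_monotone A : Prop :=
  monotone_op A /\ forall A', monotone_op A' -> ~ (gra A `<` gra A').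

Definition cocoercive (beta : R) B : Prop :=
  forall x y, dot (x - y) (B x - B y) >= beta * `|B x - B y| ^+ 2.

Definition weak_cvg (x : H^nat) (l : H) : Prop :=
  forall z, dot (x n) z @[n --> \oo] --> dot l z.

Definition demiregular A (x : H) : Prop :=
  dom A x /\
  forall (xs us : H^nat) (u : H), (forall n, gra A (xs n, us n)) -> A x u ->
    weak_cvg xs x -> us @ \oo --> u -> xs @ \oo --> x.

End HilbertSpace.

(* Main.v *)
Require Import Defs.
From HB Require Import structures.
From mathcomp Require Import all_boot all_order all_algebra.
From mathcomp Require Import all_classical all_reals all_analysis.
From mathcomp Require Import ring lra.
Import Order.TTheory GRing.Theory Num.Theory.
Import numFieldNormedType.Exports.

Set Implicit Arguments.
Unset Strict Implicit.
Unset Printing Implicit Defensive.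

Local Open Scope classical_set_scope.
Local Open Scope ring_scope.

(** Let [W n] be the inverse of [U n]. The quadratic forms of the [W n] are
    uniformly equivalent to the squared norm, and since inversion reverses the
    order of positive operators, the hypothesis on [U] says that the form of
    [W n.+1] is at most [1 + eta n] times the form of [W n] ([inverse_ge],
    [inverse_le], [inverse_antitone]). All distances are measured with these
    forms.

    A point [z] is a zero of [A + B] if and only if [- B z] belongs to [A z].
    Let [q n] be the resolvent of the unperturbed forward step. Monotonicity of
    [A] between [q n] and [z], together with the cocoercivity of [B], shows that
    [q n] is closer to [z] than [x n], with a gain controlling both the square
    of [B (x n) - B z] and that of [x n - q n - gamma n *: U n (B (x n) - B z)]
    ([forward_backward_decrease]). Relaxation, the errors [a] and [b] and the
    change of metric only cost a factor [1 + zeta n] and a term [kappa n], both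
    summable and independent of [z] ([fejer_inequality]). Hence the distance to
    each zero converges and the gains are summable: so are the squares of the
    norms of [B (x n) - B z], and [x n - q n] tends to 0.

    For weak convergence, bounded sequences have weak limits along ultrafilters
    ([ultra_weak_cvg]). Along each of them the points [w n] of [A (q n)]
    converge strongly to [- B z], so that the limit is a zero
    ([weak_cluster_zero]). Being almost decreasing, the operators [W n] converge
    pointwise ([metric_cvg]), and the argument of Opial, adapted to a variable
    metric, shows that all these weak limits coincide ([opial]).

    For strong convergence, when the lower limit of the distance to [Z] is 0,
    coming close to some point of [Z] confines the rest of the sequence near that
    point ([fejer_strong]). Demiregularity applies directly to [q n] or to [x n].
    When [Z] has an interior point [z0], the inequality holds for all the points
    of a ball, which makes the increments of [W n (x n - z0)] summable
    ([interior_metric_cvg]); strong convergence of this sequence upgrades the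
    weak convergence of [x] ([weak_to_strong]).

    That the resolvents are defined everywhere is the theorem of Minty in the
    metric of a coercive operator ([minty]). Its proof minimizes the Fitzpatrick
    function of [A] plus a quadratic form. The same minimization principle
    ([epigraph_min]) gives the theorem of Lax and Milgram ([lax_milgram]), which
    provides the operators [W n] and, for the identity operator, the Riesz
    representation of weak limits. *)

(** * Summable sequences and almost decreasing sequences *)

Section RealSequences.
Context {R : realType}.
Implicit Types u v zeta kappa delta : R^nat.

Lemma seriesSn u n : series u n.+1 = series u n + u n.
Proof. by rewrite /series /= big_nat_recr. Qed.

Lemma series_ge0 u n : (forall k, 0 <= u k) -> 0 <= series u n.
Proof. by move=> u0; apply: sumr_ge0. Qed.

Lemma l1_plus_ub u : l1_plus u -> exists2 M, 0 <= M & forall n, series u n <= M.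
Proof.
move=> [u0 cu]; have ub n : series u n <= limn (series u).
  by apply: nondecreasing_cvgn_le => //; exact: nondecreasing_series.
by exists (limn (series u)) => //; apply: le_trans (ub 0%N); exact: series_ge0.
Qed.

Lemma l1_plus_term_ub u :
  l1_plus u -> exists2 M, 0 <= M & forall n, u n <= M.
Proof.
move=> lu; have [M M0 uM] := l1_plus_ub lu; exists M => // n.
by apply: le_trans (uM n.+1); rewrite seriesSn lerDr series_ge0//; case: lu.
Qed.

Lemma l1_plus_bounded u (M : R) :
  (forall n, 0 <= u n) -> (forall n, series u n <= M) -> l1_plus u.
Proof.
move=> u0 uM; split => //; apply: nondecreasing_is_cvgn.
  exact: nondecreasing_series.
by exists M => _ [n _ <-].
Qed.

Lemma l1_plus_le u v :
  (forall n, 0 <= u n <= v n) -> l1_plus v -> l1_plus u.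
Proof.
move=> uv [v0 cv]; split => [n|]; first by case/andP: (uv n).
by apply: series_le_cvg cv => // n; case/andP: (uv n).
Qed.

Lemma l1_plusD u v : l1_plus u -> l1_plus v -> l1_plus (fun n => u n + v n).
Proof.
move=> [u0 cu] [v0 cv]; split => [n|]; first exact: addr_ge0.
exact: (is_cvg_seriesD cu cv).
Qed.

Lemma l1_plusZ (c : R) u : 0 <= c -> l1_plus u -> l1_plus (fun n => c * u n).
Proof.
move=> c0 [u0 cu]; split => [n|]; first exact: mulr_ge0.
exact: (@is_cvg_seriesZ _ u c cu).
Qed.

(** Subtracting [series delta n] makes both [u n] and [u n + series v n]
    nonincreasing. *)
Lemma almost_decreasing u v delta :
  (forall n, 0 <= u n) -> (forall n, 0 <= v n) -> l1_plus delta ->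
  (forall n, u n.+1 + v n <= u n + delta n) ->
  cvgn u /\ l1_plus v.
Proof.
move=> u0 v0 ldelta uv; have [D D0 dD] := l1_plus_ub ldelta.
have uvE n : u n + series v n <= u 0%N + series delta n.
  elim: n => [|n IH]; first by rewrite /series /= !big_geq.
  by rewrite !seriesSn; have := uv n; lra.
split; last first.
  apply: (@l1_plus_bounded _ (u 0%N + D)) => // n.
  by have := uvE n; have := u0 n; have := dD n; lra.
rewrite (_ : u = (u \- series delta) \+ series delta); last first.
  by apply/funext => n /=; rewrite subrK.
apply: is_cvgD; last by case: ldelta.
apply: nonincreasing_is_cvgn.
  apply/nonincreasing_seqP => n /=.
  by rewrite seriesSn; have := uv n; have := v0 n; lra.
by exists (- D) => _ [n _ <-] /=; have := u0 n; have := dD n; lra.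
Qed.

(** A discrete Gronwall inequality, by [1 + z <= expR z]. The bound involves
    [kappa] only after time [n], and so controls the sequence from any time on. *)
Lemma gronwall_bound u zeta kappa (S : R) :
  (forall n, 0 <= u n) -> (forall n, 0 <= zeta n) -> (forall n, 0 <= kappa n) ->
  (forall n, u n.+1 <= (1 + zeta n) * u n + kappa n) ->
  (forall n, series zeta n <= S) ->
  forall n k, u (n + k)%N
    <= expR S * (u n + (series kappa (n + k)%N - series kappa n)).
Proof.
move=> u0 z0 k0 uS zS n k.
have zmon m j : series zeta m <= series zeta (m + j)%N.
  by apply: nondecreasing_series; rewrite ?leq_addr.
have kmon m j : series kappa m <= series kappa (m + j)%N.
  by apply: nondecreasing_series; rewrite ?leq_addr.
have step : u (n + k)%N <= expR (series zeta (n + k)%N - series zeta n)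
    * (u n + (series kappa (n + k)%N - series kappa n)).
  elim: k => [|k IH]; first by rewrite addn0 !subrr expR0 mul1r addr0.
  rewrite addnS !seriesSn; apply: le_trans (uS _) _.
  set s := series zeta (n + k)%N - _ in IH *; set t := series kappa (n + k)%N in IH *.
  have -> : series zeta (n + k)%N + zeta (n + k)%N - series zeta n
    = zeta (n + k)%N + s by rewrite /s; ring.
  have s0 : 0 <= s by rewrite subr_ge0.
  have E : 1 <= expR (zeta (n + k)%N + s) by rewrite -expR0 ler_expR addr_ge0.
  apply: (@le_trans _ _ (expR (zeta (n + k)%N + s) * (u n + (t - series kappa n))
      + kappa (n + k)%N)).
    rewrite lerD2r expRD -mulrA; apply: ler_pM => //.
    - by rewrite addr_ge0.
    - exact: expR_ge1Dx.
  have := k0 (n + k)%N; have := expR_gt0 (zeta (n + k)%N + s); nra.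
apply: le_trans step _; apply: ler_wpM2r.
  by rewrite addr_ge0// subr_ge0.
rewrite ler_expR; have := zS (n + k)%N; have := series_ge0 n z0; lra.
Qed.

(** The bound of [gronwall_bound] turns the multiplicative error
    [zeta n * u n] into a summable additive one. *)
Lemma quasi_fejer_seq u v zeta kappa :
  (forall n, 0 <= u n) -> (forall n, 0 <= v n) ->
  l1_plus zeta -> l1_plus kappa ->
  (forall n, u n.+1 + v n <= (1 + zeta n) * u n + kappa n) ->
  cvgn u /\ l1_plus v.
Proof.
move=> u0 v0 lz lk uv.
have [S S0 zS] := l1_plus_ub lz; have [K K0 kK] := l1_plus_ub lk.
have uM n : u n <= expR S * (u 0%N + K).
  have uS m : u m.+1 <= (1 + zeta m) * u m + kappa m.
    by have := uv m; have := v0 m; lra.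
  apply: le_trans (gronwall_bound u0 (proj1 lz) (proj1 lk) uS zS 0 n) _.
  rewrite add0n ler_wpM2l ?expR_ge0// lerD2l.
  by have := kK n; have := series_ge0 0 (proj1 lk); lra.
have M0 := le_trans (u0 0%N) (uM 0%N).
apply: (almost_decreasing u0 v0 (l1_plusD (l1_plusZ M0 lz) lk)) => n.
by have := uv n; have := uM n; have := proj1 lz n; nra.
Qed.

Lemma cvg_of_sqr_tail (V : completeNormedModType R) (w : V^nat) (g : R^nat) :
  g @ \oo --> (0 : R) ->
  (forall n m, (n <= m)%N -> `|w n - w m| ^+ 2 <= g n) -> cvgn w.
Proof.
move=> g0 wg; apply/cauchy_cvgP/cauchy_exP => e e0.
have e20 : 0 < e ^+ 2 by rewrite exprn_gt0.
have /cvgrPdist_lt/(_ _ e20)[N _ HN] := g0.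
exists (w N); exists N => // m /= Nm; rewrite -ball_normE /=.
have gN : g N < e ^+ 2.
  by have := HN N (leqnn N); rewrite sub0r normrN; apply: le_lt_trans (ler_norm _).
by rewrite -(ltr_pXn2r (n := 2)) ?nnegrE ?normr_ge0 ?(ltW e0)// (le_lt_trans (wg _ _ Nm)).
Qed.

End RealSequences.

(** * Inner products and positive self-adjoint operators *)

Section InnerProduct.
Context {R : realType} {H : completeNormedModType R}.
Variable dot : {dot H for (@idfun R)}.
Hypothesis hdot : hilbert_product dot.
Implicit Types (x y z : H) (T : {linear H -> H}).

Lemma dotC x y : dot x y = dot y x.
Proof. by rewrite hermC /= expr0 mul1r. Qed.

Lemma dotDl x y z : dot (x + y) z = dot x z + dot y z.
Proof. exact: linearDl. Qed.

Lemma dotDr x y z : dot z (x + y) = dot z x + dot z y.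
Proof. exact: linearDr. Qed.

Lemma dotNl x z : dot (- x) z = - dot x z.
Proof. exact: linearNl. Qed.

Lemma dotNr x z : dot z (- x) = - dot z x.
Proof. exact: linearNr. Qed.

Lemma dotZl c x z : dot (c *: x) z = c * dot x z.
Proof. by rewrite linearZl_LR. Qed.

Lemma dotZr c x z : dot z (c *: x) = c * dot z x.
Proof. by rewrite dotC dotZl dotC. Qed.

Lemma dot0l z : dot 0 z = 0.
Proof. exact: linear0l. Qed.

Definition dotE := (dotDl, dotDr, dotNl, dotNr, dotZl, dotZr).

Definition self_adjoint T := forall x y, dot (T x) y = dot x (T y).

Lemma discriminant_le (p q r : R) :
  (forall t, 0 <= p + t * q *+ 2 + t ^+ 2 * r) -> 0 <= r -> q ^+ 2 <= p * r.
Proof.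
move=> h; rewrite le_eqVlt => /predU1P[r0|r0].
  subst r; rewrite mulr0; have [->|q0] := eqVneq q 0; first by rewrite expr0n.
  have := h (- (p + 1) / (2 * q)).
  rewrite (_ : _ * q *+ 2 = - (p + 1)) ?mulr0; last by field; rewrite q0.
  by move=> ?; exfalso; lra.
have := h (- q / r).
rewrite (_ : p + _ + _ = (p * r - q ^+ 2) / r); last by field; rewrite gt_eqF.
by rewrite pmulr_lge0 ?invr_gt0// subr_ge0.
Qed.

Lemma psd_cauchy_schwarz T : self_adjoint T -> (forall x, 0 <= dot (T x) x) ->
  forall x y, dot (T x) y ^+ 2 <= dot (T x) x * dot (T y) y.
Proof.
move=> sT T0 x y; apply: discriminant_le => // t.
have := T0 (x + t *: y); rewrite (linearD T) (linearZ_LR T) !dotE.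
have -> : dot (T y) x = dot (T x) y by rewrite sT dotC.
by congr (0 <= _); ring.
Qed.

Lemma cauchy_schwarz x y : `|dot x y| <= `|x| * `|y|.
Proof.
rewrite -(ler_pXn2r (n := 2)) ?nnegrE ?mulr_ge0// exprMn -!hdot real_normK ?num_real//.
by apply: (@psd_cauchy_schwarz idfun) => // z; rewrite /= hdot sqr_ge0.
Qed.

Lemma dot_le x y : dot x y <= `|x| * `|y|.
Proof. exact: le_trans (ler_norm _) (cauchy_schwarz x y). Qed.

(** This is the Cauchy-Schwarz inequality for the form of [T], at [x] and
    [T x]. *)
Lemma sqr_norm_psd_le T (M : R) : self_adjoint T ->
  (forall x, 0 <= dot (T x) x <= M * `|x| ^+ 2) ->
  forall x, `|T x| ^+ 2 <= M * dot (T x) x.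
Proof.
move=> sT TM x.
have T0 z : 0 <= dot (T z) z by case/andP: (TM z).
have := psd_cauchy_schwarz sT T0 x (T x); rewrite hdot.
have /andP[_] := TM (T x); have /andP[] := TM x.
have [->|Tx0] := eqVneq (T x) 0.
  by rewrite normr0 expr0n /= dot0l mulr0.
have : 0 < `|T x| ^+ 2 by rewrite exprn_gt0// normr_gt0.
set a := `|T x| ^+ 2; set b := dot (T x) x; set c := dot _ (T x).
move=> a0 b0 bM cM h; rewrite -(ler_pM2r a0) -[a * a]expr2.
by apply: le_trans h _; nra.
Qed.

Lemma lipschitz_cvg (T : H -> H) (M : R) {I} (F : set_system I) {FF : Filter F} (f : I -> H) l :
  (forall x y, T (x - y) = T x - T y) -> (forall x, `|T x| <= M * `|x|) ->
  f @ F --> l -> (T \o f) @ F --> T l.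
Proof.
move=> TB TM fl; apply/cvgrPdist_le => e e0.
have M0 : 0 < `|M| + 1 by have := normr_ge0 M; lra.
have /cvgrPdist_le/(_ (e / (`|M| + 1))) := fl; rewrite divr_gt0// => /(_ isT).
apply: filterS => i hi; rewrite /= -TB; apply: le_trans (TM _) _.
move: hi; rewrite ler_pdivlMr// => hi; have := ler_norm M; have := normr_ge0 (l - f i); nra.
Qed.

End InnerProduct.

(** * Weak convergence along a filter *)

Section Filters.
Context {R : realType} {H : completeNormedModType R}.
Variable dot : {dot H for (@idfun R)}.
Hypothesis hdot : hilbert_product dot.
Context {I : Type} (F : set_system I) {FF : Filter F}.
Implicit Types (f g : I -> H) (l m : H).

(** Weak convergence along an arbitrary filter: ultrafilters on [nat] take the
    place of subsequences. *)
Definition weak_cvg_along f l := forall z, dot (f n) z @[n --> F] --> dot l z.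

Lemma weak_cvg_alongB f g l : weak_cvg_along f l -> (f n - g n) @[n --> F] --> 0 ->
  weak_cvg_along g l.
Proof.
move=> fl fg0 z; rewrite -[dot l z]subr0.
rewrite (_ : (fun n => _) = fun n => dot (f n) z - dot (f n - g n) z); last first.
  by apply/funext => n; rewrite !dotE; ring.
apply: cvgB => //.
apply/cvgr0Pnorm_le => e e0.
have z0 : 0 < `|z| + 1 by have := normr_ge0 z; lra.
have /cvgr0Pnorm_le/(_ (e / (`|z| + 1))) := fg0; rewrite divr_gt0// => /(_ isT).
apply: filterS => n; rewrite ler_pdivlMr// => h.
apply: le_trans (cauchy_schwarz hdot _ _) _.
by have := normr_ge0 (f n - g n); nra.
Qed.

Lemma weak_cvg_along_subr f l m :
  weak_cvg_along f l -> weak_cvg_along (fun n => f n - m) (l - m).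
Proof.
move=> fl z; rewrite dotDl dotNl.
rewrite (_ : (fun n => _) = fun n => dot (f n) z - dot m z).
  by apply: cvgB => //; exact: cvg_cst.
by apply/funext => n; rewrite dotDl dotNl.
Qed.

Lemma weak_strong_cvg f g l m (M : R) :
  (forall n, `|f n| <= M) -> weak_cvg_along f l -> g @ F --> m ->
  dot (f n) (g n) @[n --> F] --> dot l m.
Proof.
move=> fM fl gm; rewrite -[dot l m]subr0.
rewrite (_ : (fun n => _) = fun n => dot (f n) m - dot (f n) (m - g n)); last first.
  by apply/funext => n; rewrite !dotE; ring.
apply: cvgB => //.
apply/cvgr0Pnorm_le => e e0.
have M0 : 0 < `|M| + 1 by have := normr_ge0 M; lra.
have /cvgrPdist_le/(_ (e / (`|M| + 1))) := gm; rewrite divr_gt0// => /(_ isT).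
apply: filterS => n; rewrite ler_pdivlMr// => h.
apply: le_trans (cauchy_schwarz hdot _ _) _.
by have := fM n; have := ler_norm M; have := normr_ge0 (f n); have := normr_ge0 (m - g n); nra.
Qed.

Lemma strong_weak_cvg f l : f @ F --> l -> weak_cvg_along f l.
Proof.
move=> fl; apply: (@weak_cvg_alongB (cst l)); first by move=> z; exact: cvg_cst.
by rewrite -(subrr l); apply: cvgB => //; exact: cvg_cst.
Qed.

End Filters.

(** * Minimization of strongly convex functions *)

Section Minimization.
Context {R : realType} {V : completeNormedModType R}.

(** The relation [E] is the epigraph of a function that may take the value
    plus infinity. The strong convexity at midpoints makes every minimizing
    sequence a Cauchy sequence. *)
Lemma epigraph_min (E : V -> V -> R -> Prop) (c lb : R) :
  0 < c -> (exists x u t, E x u t) -> (forall x u t, E x u t -> lb <= t) ->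
  (forall x u s y v t, E x u s -> E y v t ->
     E (2^-1 *: (x + y)) (2^-1 *: (u + v))
       ((s + t) / 2 - c * (`|x - y| ^+ 2 + `|u - v| ^+ 2))) ->
  (forall (xs us : V^nat) (ts : R^nat) x u t,
     (forall n, E (xs n) (us n) (ts n)) ->
     xs @ \oo --> x -> us @ \oo --> u -> ts @ \oo --> t -> E x u t) ->
  exists x u m, E x u m /\ forall y v t, E y v t -> m <= t.
Proof.
move=> c0 [x0 [u0 [t0 E0]]] Elb Emid Ecl.
pose S := [set t | exists x u, E x u t].
have S0 : has_inf S.
  by split; [exists t0, x0, u0|exists lb => t [x [u /Elb]]].
have mE x u t : E x u t -> inf S <= t.
  by move=> h; apply: ge_inf; [case: S0|exists x, u].
have /choice[f fP] n : exists z : V * V * R,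
    E z.1.1 z.1.2 z.2 /\ z.2 < inf S + harmonic n.
  have [t [x [u h]] tS] := inf_adherent (harmonic_gt0 n : 0 < _ :> R) S0.
  by exists (x, u, t).
pose xs n := (f n).1.1; pose us n := (f n).1.2; pose ts n := (f n).2.
have gap n k : (n <= k)%N ->
    c * (`|xs n - xs k| ^+ 2 + `|us n - us k| ^+ 2) <= harmonic n.
  move=> nk; have [En tn] := fP n; have [Ek tk] := fP k.
  have := mE _ _ _ (Emid _ _ _ _ _ _ En Ek).
  have : harmonic k <= harmonic n :> R by rewrite /= lef_pV2 ?posrE// ler_nat.
  by rewrite /xs /us; lra.
have h0 : (fun n => c^-1 * harmonic n) @ \oo --> (0 : R).
  by rewrite -(mulr0 c^-1); apply: cvgMl_tmp; exact: cvg_harmonic.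
have cx : cvgn xs.
  apply: (cvg_of_sqr_tail h0) => n k /gap h; rewrite ler_pdivlMl//.
  by apply: le_trans h; rewrite ler_pM2l// lerDl sqr_ge0.
have cu : cvgn us.
  apply: (cvg_of_sqr_tail h0) => n k /gap h; rewrite ler_pdivlMl//.
  by apply: le_trans h; rewrite ler_pM2l// lerDr sqr_ge0.
exists (limn xs), (limn us), (inf S); split; last exact: mE.
apply: (Ecl xs us ts) => //; first by move=> n; case: (fP n).
apply: (@squeeze_cvgr _ _ _ _ (cst (inf S)) (fun n => inf S + harmonic n)).
- apply: nearW => n; have [En tn] := fP n.
  by rewrite /= (mE _ _ _ En) /= ltW.
- exact: cvg_cst.
- rewrite -[X in _ --> X]addr0; apply: cvgD; [exact: cvg_cst|exact: cvg_harmonic].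
Qed.

End Minimization.

(** * Coercive operators and the theorem of Lax and Milgram *)

Section CoerciveOperators.
Context {R : realType} {H : completeNormedModType R}.
Variable dot : {dot H for (@idfun R)}.
Hypothesis hdot : hilbert_product dot.
Implicit Types (x y z u v : H).

Lemma dot_cvg (f g : H^nat) l m :
  f @ \oo --> l -> g @ \oo --> m -> dot (f n) (g n) @[n --> \oo] --> dot l m.
Proof.
move=> fl gm.
have cf : cvgn f by apply/cvg_ex; exists l.
have [M [_ fM]] := cvg_seq_bounded cf.
apply: (@weak_strong_cvg _ _ _ hdot _ _ _ f g l m (M + 1)) => //.
  by move=> n; apply: fM => //; rewrite ltrDl.
exact: strong_weak_cvg.
Qed.

Variable (T : {linear H -> H}) (M tau : R).
Hypothesis T_bounded : forall x, `|T x| <= M * `|x|.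
Hypothesis T_sa : self_adjoint dot T.
Hypothesis tau_gt0 : 0 < tau.
Hypothesis T_coercive : forall x, tau * `|x| ^+ 2 <= dot (T x) x.

Lemma coercive_cvg (f : H^nat) l : f @ \oo --> l -> T (f n) @[n --> \oo] --> T l.
Proof. by move=> fl; apply: (lipschitz_cvg (linearB T) T_bounded). Qed.

Lemma dotTC x y : dot (T x) y = dot (T y) x.
Proof. by rewrite T_sa dotC. Qed.

Lemma coercive_ge0 x : 0 <= dot (T x) x.
Proof. by apply: le_trans (T_coercive x); rewrite mulr_ge0 ?sqr_ge0// ltW. Qed.

Lemma coercive_eq0 x : dot (T x) x <= 0 -> x = 0.
Proof.
move=> h; apply/eqP; rewrite -normr_eq0 -sqrf_eq0 eq_le sqr_ge0 andbT.
by rewrite -(pmulr_rle0 _ tau_gt0) (le_trans (T_coercive x)).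
Qed.

(** The solution is the minimizer of [phi]. The second variable in the
    epigraph is a dummy; the term [tau / 2 * dot u u] makes the function strongly
    convex in it. *)
Lemma lax_milgram (g : H -> R) (K : R) :
  (forall x y, g (x + y) = g x + g y) -> (forall c x, g (c *: x) = c * g x) ->
  (forall x, `|g x| <= K * `|x|) -> exists w, forall z, dot (T w) z = g z.
Proof.
move=> gD gZ gK.
pose phi x := 2^-1 * dot (T x) x - g x.
pose E x u t := phi x + tau / 2 * dot u u <= t.
have [x [u [m [Em mmin]]]] : exists x u m, E x u m /\ forall y v t, E y v t -> m <= t.
  apply: (@epigraph_min _ _ E (tau / 8) (- (K ^+ 2 / (2 * tau)))).
  - by rewrite divr_gt0.
  - by exists 0, 0, (phi 0 + tau / 2 * dot 0 0); exact: lexx.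
  - move=> x u t; apply: le_trans; rewrite /phi hdot.
    have := T_coercive x; have := gK x; rewrite ler_norml => /andP[_].
    have := sqr_ge0 (tau * `|x| - K); have : 0 <= tau / 2 * `|u| ^+ 2.
      by rewrite mulr_ge0 ?sqr_ge0// divr_ge0// ltW.
    set a := tau / 2 * _; move=> a0 h1 h2 h3.
    have : - (K ^+ 2 / (2 * tau)) <= 2^-1 * (tau * `|x| ^+ 2) - K * `|x|.
      rewrite -subr_ge0 (_ : _ - _ = (tau * `|x| - K) ^+ 2 / (2 * tau)); last first.
        by field; rewrite gt_eqF.
      by rewrite divr_ge0// mulr_ge0// ltW.
    by lra.
  - move=> x u s y v t Ex Ey; rewrite /E /phi.
    have Txy := T_coercive (x - y); move: Ex Ey Txy.
    rewrite /E /phi -!hdot !(linearZ_LR T, linearD T, linearN T) !dotE.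
    rewrite gZ gD (dotTC y x) (dotC dot v u); lra.
  - move=> xs us ts x u t Es xsx usu tst; rewrite /E /phi.
    have gx : g (xs n) @[n --> \oo] --> g x.
      apply/cvgrPdist_le => e e0; have K0 : 0 < `|K| + 1 by have := normr_ge0 K; lra.
      have /cvgrPdist_le/(_ (e / (`|K| + 1))) := xsx; rewrite divr_gt0// => /(_ isT).
      apply: filterS => n; rewrite ler_pdivlMr// => h.
      have -> : g x - g (xs n) = g (x - xs n).
        by rewrite gD; have := gZ (-1) (xs n); rewrite scaleN1r mulN1r => ->.
      by apply: le_trans (gK _) _; have := ler_norm K; have := normr_ge0 (x - xs n); nra.
    apply: (@ler_cvg_to _ \oo _ _ (fun n => phi (xs n) + tau / 2 * dot (us n) (us n)) ts).
    + apply: cvgD; last by apply: cvgMl_tmp; exact: dot_cvg.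
      apply: cvgB => //; apply: cvgMl_tmp; apply: dot_cvg => //; exact: coercive_cvg.
    + exact: tst.
    + exact: nearW.
exists x => z; apply/eqP; rewrite -subr_eq0 -sqrf_eq0 eq_le sqr_ge0 andbT.
have := @discriminant_le _ 0 ((dot (T x) z - g z) / 2) (2^-1 * dot (T z) z).
rewrite mul0r exprMn => h.
suff : (dot (T x) z - g z) ^+ 2 * 2^-1 ^+ 2 <= 0 by rewrite pmulr_lle0// exprn_gt0.
apply: h; last by rewrite mulr_ge0// coercive_ge0.
move=> t; have := mmin (x + t *: z) u _ (lexx _); move: Em.
rewrite /E /phi !(linearZ_LR T, linearD T) !dotE gD gZ (dotTC z x); lra.
Qed.

Lemma coercive_surj y : exists w, T w = y.
Proof.
have [||z|w wP] := @lax_milgram (dot y) `|y|.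
- by move=> *; exact: dotDr.
- by move=> *; exact: dotZr.
- exact: cauchy_schwarz.
exists w; apply/eqP; rewrite -subr_eq0 -normr_eq0 -sqrf_eq0 -hdot dotDl dotNl.
by rewrite wP subrr.
Qed.

Lemma coercive_inverse : exists W : {linear H -> H}, forall y, T (W y) = y.
Proof.
have /choice[W WP] := coercive_surj.
have Tinj x y : T x = T y -> x = y.
  move=> e; apply/eqP; rewrite -subr_eq0; apply/eqP/coercive_eq0.
  by rewrite (linearB T) e subrr dot0l.
have Wlin : linear W.
  by move=> c x y; apply: Tinj; rewrite (linearP T) !WP.
pose Wl : {linear H -> H} := HB.pack W (GRing.isLinear.Build R H H *:%R W Wlin).
by exists Wl.
Qed.

(** * The theorem of Minty in a variable metric *)

(** Otherwise adjoining [(q, w)] to the graph would give a proper monotone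
    extension of [A]. *)
Lemma maximally_monotone_mem (A : H -> set H) q w : maximally_monotone dot A ->
  (forall p v, A p v -> 0 <= dot (p - q) (v - w)) -> A q w.
Proof.
move=> [mA maxA] h; apply: contrapT => nA.
pose A' x := A x `|` [set u | x = q /\ u = w].
apply: (maxA A').
  move=> x u y v; rewrite /gra /A' /= => -[Axu|[-> ->]] [Ayv|[-> ->]].
  - exact: mA Axu Ayv.
  - exact: h.
  - by rewrite -opprB -(opprB v) dotNl dotNr opprK; exact: h.
  - by rewrite subrr dot0l.
split; first by move=> [x u] Axu; left.
by move=> /(_ (q, w)) sub; apply: nA; apply: sub; right.
Qed.

(** Divide by [t] and let [t] tend to 0. *)
Lemma ge0_of_quad (a b : R) :
  (forall t, 0 <= t <= 1 -> 0 <= t * a + t ^+ 2 * b) -> 0 <= a.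
Proof.
move=> h; rewrite leNgt; apply/negP => a0.
have b0 : 0 < `|b| + 1 by have := normr_ge0 b; lra.
pose t := Num.min 1 (- a / (2 * (`|b| + 1))).
have t0 : 0 < t by rewrite lt_min ltr01 divr_gt0 ?oppr_gt0// mulr_gt0.
have t1 : t <= 1 by rewrite ge_min lexx.
have ta : t * (2 * (`|b| + 1)) <= - a.
  by rewrite -ler_pdivlMr ?mulr_gt0// ge_min lexx orbT.
have := h t; rewrite t1 (ltW t0) => /(_ isT); have := ler_norm b.
rewrite expr2 -mulrA -mulrDr pmulr_rge0// => hb ?.
have : t * b <= t * (`|b| + 1) by rewrite ler_pM2l//; lra.
lra.
Qed.

(** This is the argument of Simons and Zalinescu. The function with epigraph
    [E] is the Fitzpatrick function of the translate of [A] by [y], evaluated at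
    [(T x, u)], plus half the form of [T] at [x] and at [u]. Its minimum is
    nonnegative by maximality of [A]. Let it be attained at [(x, u)]: comparing
    with its values on the graph of [A], along segments, gives
    [dot (p - (y - T u)) (v + x) >= 2^-1 * Q (x + u)] on the graph. By maximality
    again [- x] belongs to [A (y - T u)], and choosing this point of the graph
    for [(p, v)] forces [x + u = 0]. *)
Lemma minty (A : H -> set H) y : maximally_monotone dot A ->
  exists p w, A p w /\ p + T w = y.
Proof.
move=> mA.
pose Q x := dot (T x) x.
pose L x u p v := dot (T x) v + dot (p - y) u - dot (p - y) v + 2^-1 * Q x + 2^-1 * Q u.
pose E x u t := forall p v, A p v -> L x u p v <= t.
have Econv x u s x' u' t th : E x u s -> E x' u' t -> 0 <= th <= 1 ->
    E ((1 - th) *: x + th *: x') ((1 - th) *: u + th *: u')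
      ((1 - th) * s + th * t
        - 2^-1 * (th * (1 - th)) * (Q (x - x') + Q (u - u'))).
  move=> Ex Ex' /andP[th0 th1] p v Apv.
  have -> : L ((1 - th) *: x + th *: x') ((1 - th) *: u + th *: u') p v =
      (1 - th) * L x u p v + th * L x' u' p v
      - 2^-1 * (th * (1 - th)) * (Q (x - x') + Q (u - u')).
    rewrite /L /Q !(linearZ_LR T, linearD T, linearN T) !dotE.
    by rewrite (dotTC x' x) (dotTC u' u); field.
  rewrite lerB// lerD// ler_wpM2l ?subr_ge0//; [exact: Ex|exact: Ex'].
(* On the graph, the Fitzpatrick function is equal to the pairing. *)
have Egra z p v : A p v -> T z = p - y ->
    E z v (dot (p - y) v + 2^-1 * Q z + 2^-1 * Q v).
  move=> Apv Tz p' v' Apv'; rewrite /L Tz.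
  have := (proj1 mA) p v p' v' Apv Apv'; rewrite !dotE; lra.
(* A negative value would make [(y + T x, u)] monotonically related to the
   graph with a strict inequality, which fails at this very point. *)
have Elb x u t : E x u t -> 0 <= t.
  move=> Exut; rewrite leNgt; apply/negP => t0.
  have key p v : A p v -> - t <= dot (p - (y + T x)) (v - u).
    move=> /Exut; have := coercive_ge0 (x + u).
    rewrite /L /Q !(linearD T) !dotE (dotTC u x) (dotC dot p u); lra.
  have Axu : A (y + T x) u.
    by apply: maximally_monotone_mem => // p v /key; lra.
  by have := key _ _ Axu; rewrite subrr dot0l; lra.
have [x [u [m [Em mmin]]]] : exists x u m, E x u m /\ forall y v t, E y v t -> m <= t.
  apply: (@epigraph_min _ _ E (tau / 8) 0) => //.
  - by rewrite divr_gt0.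
  - have [[p [v Apv]]|noA] := pselect (exists p v, A p v).
      have [z Tz] := coercive_surj (p - y).
      by exists z, v, (dot (p - y) v + 2^-1 * Q z + 2^-1 * Q v); exact: Egra Apv Tz.
    exists 0, 0, 0 => p v Apv; exfalso; apply: noA; by exists p, v.
  - move=> x u s x' u' t Ex Ex'.
    have h01 : 0 <= (2^-1 : R) <= 1 by apply/andP; split; lra.
    have := Econv _ _ _ _ _ _ _ Ex Ex' h01.
    have -> : 1 - 2^-1 = 2^-1 :> R by field.
    move=> h p v /h.
    rewrite -(scalerDr _ x) -(scalerDr _ u) => /le_trans; apply.
    by have := T_coercive (x - x'); have := T_coercive (u - u'); rewrite -/(Q _) -/(Q _); lra.
  - move=> xs us ts x u t Es xsx usu tst p v Apv.
    apply: (@ler_cvg_to _ \oo _ _ (fun n => L (xs n) (us n) p v) ts).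
    + have Tx := coercive_cvg xsx; have Tu := coercive_cvg usu.
      apply: cvgD; last by apply: cvgMl_tmp; exact: dot_cvg.
      apply: cvgD; last by apply: cvgMl_tmp; exact: dot_cvg.
      apply: cvgB; last exact: cvg_cst.
      by apply: cvgD; apply: dot_cvg => //; exact: cvg_cst.
    + exact: tst.
    + by apply: nearW => n; exact: Es.
have m0 := Elb _ _ _ Em.
have key p v : A p v -> m + 2^-1 * Q (x + u) <= dot (p - (y - T u)) (v - - x).
  move=> Apv; have [z Tz] := coercive_surj (p - y).
  have := @ge0_of_quad (dot (p - y) v + 2^-1 * Q z + 2^-1 * Q v - m
      - 2^-1 * (Q (x - z) + Q (u - v))) (2^-1 * (Q (x - z) + Q (u - v))).
  have h t : 0 <= t <= 1 -> 0 <= t * (dot (p - y) v + 2^-1 * Q z + 2^-1 * Q v - m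
      - 2^-1 * (Q (x - z) + Q (u - v))) + t ^+ 2 * (2^-1 * (Q (x - z) + Q (u - v))).
    move=> t01; have := mmin _ _ _ (Econv _ _ _ _ _ _ t Em (Egra _ _ _ Apv Tz) t01).
    by rewrite -subr_ge0; congr (0 <= _); ring.
  move=> /(_ h); rewrite opprB addrA (addrAC p) -Tz opprK.
  rewrite /Q !(linearD T, linearN T) !dotE (dotTC u x) (dotTC z x) (dotTC v u); lra.
have Q0 : 0 <= Q (x + u) := coercive_ge0 _.
have Aq : A (y - T u) (- x).
  by apply: maximally_monotone_mem => // p v /key; lra.
have xu : x + u = 0.
  by apply: coercive_eq0; rewrite -/(Q _); have := key _ _ Aq; rewrite subrr dot0l; lra.
exists (y - T u), (- x); split => //.
by rewrite (addr0_eq xu) subrK.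
Qed.

End CoerciveOperators.

(** * Weak compactness of bounded sequences *)

Section WeakCompactness.
Context {R : realType}.

Lemma ultra_bounded_cvg (I : Type) (F : set_system I) (f : I -> R) (M : R) :
  UltraFilter F -> (forall n, `|f n| <= M) -> exists l : R, f @ F --> l.
Proof.
move=> UF fM.
have [l [_ lcl]] : exists l : R, (`[- M, M]%classic `&` cluster (fmap f F)) l.
  apply: (@segment_compact R (- M) M).
  by apply: nearW => n; rewrite /= in_itv /= -ler_norml.
exists l => B lB; have [//|nB] := in_ultra_setVsetC (f @^-1` B) UF.
by have [b []] := lcl (~` B) B nB lB.
Qed.

(** If [f] does not converge to [l] along [F], then [F] together with the
    complement of the preimage of some neighbourhood of [l] generates a proper
    filter, which is contained in an ultrafilter. *)
Lemma cvg_along_ultra (I : Type) (F : set_system I) {FF : ProperFilter F}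
  (f : I -> R) (l : R) :
  (forall G, UltraFilter G -> F `<=` G -> f @ G --> l) -> f @ F --> l.
Proof.
move=> h B lB; apply: contrapT => nB.
pose D := ~` (f @^-1` B).
have PF : ProperFilter (within D F).
  apply: Build_ProperFilter_ex => P FP; apply: contrapT => nP; apply: nB.
  have {}FP : F [set n | D n -> P n] by exact: FP.
  suff : F (f @^-1` B) by [].
  apply: filterS FP => n Pn /=; apply: contrapT => nBn.
  by apply: nP; exists n; exact: Pn.
have [G [UG sG]] := ultraFilterLemma PF.
have FG : F `<=` G by move=> P FP; apply: sG; apply: (@filterS _ F) FP => n Pn _.
have GD : G D by apply: sG; exact: withinT.
have GB : G (f @^-1` B) by exact: h lB.
by apply: (@filter_not_empty _ G); apply: filterS (filterI GD GB) => n [].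
Qed.

Context {H : completeNormedModType R}.
Variable dot : {dot H for (@idfun R)}.
Hypothesis hdot : hilbert_product dot.

(** The limits of the [dot (x n) z] along the ultrafilter define a bounded
    linear functional of [z]; the weak limit is the vector representing it. *)
Lemma ultra_weak_cvg (F : set_system nat) (x : H^nat) (M : R) :
  UltraFilter F -> (forall n, `|x n| <= M) ->
  exists l, weak_cvg_along dot F x l.
Proof.
move=> UF xM.
have xz z n : `|dot (x n) z| <= M * `|z|.
  by apply: le_trans (cauchy_schwarz hdot _ _) _; rewrite ler_wpM2r.
have /choice[g gP] z := @ultra_bounded_cvg nat F (fun n => dot (x n) z) _ UF (xz z).
have gD y z : g (y + z) = g y + g z.
  have h : dot (x n) (y + z) @[n --> F] --> g y + g z.
    rewrite (_ : (fun n => _) = fun n => dot (x n) y + dot (x n) z).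
      exact: cvgD.
    by apply/funext => n /=; rewrite dotDr.
  exact: (@cvg_unique _ (@norm_hausdorff _ R) _ _ _ _ (gP (y + z)) h).
have gZ (c : R) z : g (c *: z) = c * g z.
  have h : dot (x n) (c *: z) @[n --> F] --> c * g z.
    rewrite (_ : (fun n => _) = fun n => c * dot (x n) z).
      exact: cvgMl_tmp.
    by apply/funext => n /=; rewrite dotZr.
  exact: (@cvg_unique _ (@norm_hausdorff _ R) _ _ _ _ (gP (c *: z)) h).
have gM z : `|g z| <= M * `|z|.
  apply: (@ler_cvg_to _ F _ _ (fun n => `|dot (x n) z|) (cst (M * `|z|))).
  - exact: cvg_norm.
  - exact: cvg_cst.
  - by apply: nearW => n; exact: xz.
have [||||w wP] := @lax_milgram _ _ _ hdot idfun 1 1 _ _ _ _ g M gD gZ gM.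
- by move=> z /=; rewrite mul1r.
- by [].
- exact: ltr01.
- by move=> z /=; rewrite mul1r hdot.
by exists w => z; rewrite (wP z); exact: gP.
Qed.

Lemma weak_norm_le (x : H^nat) l z (r : R) :
  weak_cvg dot x l -> (\forall n \near \oo, `|x n - z| <= r) -> `|l - z| <= r.
Proof.
move=> xl xr; have r0 : 0 <= r by have [N _ /(_ N (leqnn N))] := xr; apply: le_trans.
have h : dot (l - z) (l - z) <= r * `|l - z|.
  have c1 : dot (x n - z) (l - z) @[n --> \oo] --> dot (l - z) (l - z).
    rewrite dotDl dotNl (_ : (fun n => _) = fun n => dot (x n) (l - z) - dot z (l - z)).
      by apply: cvgB; [exact: xl|exact: cvg_cst].
    by apply/funext => n; rewrite dotDl dotNl.
  apply: (ler_cvg_to c1 (cvg_cst (r * `|l - z|))).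
  apply: filterS xr => n xn; apply: le_trans (dot_le hdot _ _) _.
  by rewrite ler_wpM2r.
have [->|lz] := eqVneq (l - z) 0; first by rewrite normr0.
by rewrite -(ler_pM2r (x := `|l - z|)) ?normr_gt0// -expr2 -hdot.
Qed.

End WeakCompactness.

(** * Fejer monotone sequences in a variable metric *)

Section VariableMetric.
Context {R : realType} {H : completeNormedModType R}.
Variable dot : {dot H for (@idfun R)}.
Hypothesis hdot : hilbert_product dot.
Variables (W : nat -> {linear H -> H}) (c C : R) (eta : R^nat).
Hypothesis W_sa : forall n, self_adjoint dot (W n).
Hypothesis c_gt0 : 0 < c.
Hypothesis W_ge : forall n x, c * `|x| ^+ 2 <= dot (W n x) x.
Hypothesis W_le : forall n x, dot (W n x) x <= C * `|x| ^+ 2.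
Hypothesis eta_l1 : l1_plus eta.
Hypothesis W_mon : forall n x, dot (W n.+1 x) x <= (1 + eta n) * dot (W n x) x.

Lemma metric_ge0 n x : 0 <= dot (W n x) x.
Proof. by apply: le_trans (W_ge n x); rewrite mulr_ge0 ?sqr_ge0// ltW. Qed.

Lemma metricC n x y : dot (W n x) y = dot (W n y) x.
Proof. by rewrite W_sa dotC. Qed.

Lemma metric_sqr_norm n x : `|W n x| ^+ 2 <= C * dot (W n x) x.
Proof.
by apply: (sqr_norm_psd_le hdot) => [|z]; [exact: W_sa|rewrite metric_ge0 W_le].
Qed.

Lemma metric_norm : 0 <= C -> forall n x, `|W n x| <= C * `|x|.
Proof.
move=> C0 n x; rewrite -(ler_pXn2r (n := 2)) ?nnegrE ?mulr_ge0//.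
apply: le_trans (metric_sqr_norm n x) _; rewrite exprMn expr2 -mulrA.
by rewrite ler_wpM2l.
Qed.

(** Subtracting the scalar operator [d n] from [W n] gives a nonincreasing
    sequence of operators. By [sqr_norm_psd_le], the increments of its values at
    [x] are controlled by those of the form [f x], which is monotone and
    bounded. *)
Lemma metric_cvg : 0 <= C -> forall x, cvgn (fun n => W n x).
Proof.
move=> C0 x; have [D D0 dD] := l1_plus_ub (l1_plusZ C0 eta_l1).
pose d := series (fun n => C * eta n).
have eta0 n : 0 <= eta n by case: eta_l1.
have d_mon n m : (n <= m)%N -> d n <= d m.
  by apply: nondecreasing_series => k _ _; exact: mulr_ge0.
have d0 n : 0 <= d n by apply: series_ge0 => k; exact: mulr_ge0.
pose f z n := dot (W n z) z - d n * `|z| ^+ 2.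
have f_mon z n m : (n <= m)%N -> f z m <= f z n.
  move: n m; apply/nonincreasing_seqP => n; rewrite /f /d seriesSn.
  have := W_mon n z; have := W_le n z; have := eta0 n; nra.
have f_cvg : cvgn (f x).
  apply: nonincreasing_is_cvgn; first by move=> n m; exact: f_mon.
  exists (- (D * `|x| ^+ 2)) => _ [n _ <-].
  have := metric_ge0 n x; have := dD n; have := sqr_ge0 `|x|; rewrite /f -/(d n); nra.
pose w n := W n x - d n *: x.
have cw : cvgn w.
  apply: (@cvg_of_sqr_tail _ _ w (fun n => (C + D) * (f x n - limn (f x)))).
    rewrite -(mulr0 (C + D)) -(subrr (limn (f x))).
    by apply: cvgMl_tmp; apply: cvgB => //; exact: cvg_cst.
  move=> n m nm.
  pose S : {linear H -> H} := (W n \- W m) \+ ((d m - d n) \*: idfun).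
  have SE z : dot (S z) z = f z n - f z m.
    by rewrite /S /= !dotE hdot /f; ring.
  have -> : w n - w m = S x.
    by rewrite /S /w /= scalerBl opprB [LHS]addrACA [RHS]addrACA [X in _ + X = _]addrC.
  have /le_trans -> // : `|S x| ^+ 2 <= (C + D) * dot (S x) x.
    apply: (sqr_norm_psd_le hdot).
      move=> y z; rewrite /S /= !dotE !W_sa; ring.
    move=> z; rewrite SE subr_ge0 f_mon//= /f.
    have := W_le n z; have := metric_ge0 m z; have := dD m; have := d0 n.
    rewrite -/(d m); have := sqr_ge0 `|z|; nra.
  rewrite SE ler_wpM2l ?addr_ge0// lerB//.
  by apply: nonincreasing_cvgn_ge => // ? ?; exact: f_mon.
have -> : (fun n => W n x) = w \+ (fun n => d n *: x).
  by apply/funext => n /=; rewrite /w subrK.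
apply: is_cvgD => //; apply: is_cvgZl.
by case: (l1_plusZ C0 eta_l1).
Qed.

(** Let [l] and [l0] be weak limits of [x] along two ultrafilters. Expanding
    the distances to [l] and to [l0], which converge, shows that
    [dot (x n) (W n (l - l0))] converges. If [h] is the limit of [W n (l - l0)],
    the two ultrafilters give [dot l h = dot l0 h], and the lower bound on the
    forms yields [l = l0]. *)
Lemma opial (x : H^nat) (M : R) (Z : set H) : 0 <= C ->
  (forall n, `|x n| <= M) ->
  (forall z, Z z -> cvgn (fun n => dot (W n (x n - z)) (x n - z))) ->
  (forall F l, UltraFilter F -> \oo `<=` F -> weak_cvg_along dot F x l -> Z l) ->
  exists2 l, Z l & weak_cvg dot x l.
Proof.
move=> C0 xM Zcvg Zcl.
have [F0 [UF0 sF0]] := ultraFilterLemma (eventually_filter).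
have [l0 xl0] := ultra_weak_cvg hdot UF0 xM.
exists l0; first exact: Zcl xl0.
move=> z; apply: cvg_along_ultra => F UF sF.
have [l xl] := ultra_weak_cvg hdot UF xM.
suff -> : l0 = l by exact: xl.
have Zl := Zcl _ _ UF sF xl; have Zl0 := Zcl _ _ UF0 sF0 xl0.
have hP := @metric_cvg C0 (l - l0); set h := limn _ in hP.
pose a y n := dot (W n (x n - y)) (x n - y).
have qcvg y : cvgn (fun n => dot (W n y) y).
  apply/cvg_ex; exists (dot (limn (fun n => W n y)) y).
  by apply: (dot_cvg hdot); [exact: metric_cvg|exact: cvg_cst].
have ck : cvgn (fun n => 2^-1 *
    ((a l0 n - a l n) + (dot (W n l) l - dot (W n l0) l0))).
  apply: is_cvgM; first exact: is_cvg_cst.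
  apply: is_cvgD; apply: is_cvgB.
  - exact: Zcvg Zl0.
  - exact: Zcvg Zl.
  - exact: qcvg.
  - exact: qcvg.
have [k kP] : exists k : R, dot (x n) (W n (l - l0)) @[n --> \oo] --> k.
  exists (limn (fun n => 2^-1 *
    ((a l0 n - a l n) + (dot (W n l) l - dot (W n l0) l0)))).
  rewrite [X in X @ _](_ : _ = fun n => 2^-1 *
     ((a l0 n - a l n) + (dot (W n l) l - dot (W n l0) l0))) //.
  apply/funext => n; rewrite /a !(linearD (W n), linearN (W n)) !dotE.
  rewrite (metricC n l (x n)) (metricC n l0 (x n)) -!W_sa; by field.
have lim_h G (m : H) : ProperFilter G -> \oo `<=` G -> weak_cvg_along dot G x m ->
    dot m h = k.
  move=> PG sG xm.
  have hG : W n (l - l0) @[n --> G] --> h by move=> B hB; apply: sG; exact: hP.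
  have kG : dot (x n) (W n (l - l0)) @[n --> G] --> k.
    by move=> B hB; apply: sG; exact: kP.
  have mG : dot (x n) (W n (l - l0)) @[n --> G] --> dot m h.
    exact: (@weak_strong_cvg _ _ _ hdot _ G _ _ _ _ _ _ xM xm hG).
  exact: (@cvg_unique _ (@norm_hausdorff _ R) _ _ _ _ mG kG).
have h0 : dot (l - l0) h = 0.
  by rewrite dotDl dotNl (lim_h F)// (lim_h F0)// subrr.
have : c * `|l - l0| ^+ 2 <= dot (l - l0) h.
  apply: (@ler_cvg_to _ \oo _ _ (cst (c * `|l - l0| ^+ 2))
    (fun n => dot (l - l0) (W n (l - l0)))).
  - exact: cvg_cst.
  - by apply: (dot_cvg hdot); [exact: cvg_cst|exact: hP].
  - by apply: nearW => n /=; rewrite dotC.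
rewrite h0 pmulr_rle0// => e; apply/esym/eqP; rewrite -subr_eq0 -normr_eq0 -sqrf_eq0.
by rewrite eq_le e sqr_ge0.
Qed.

(** The form of [W n] at [x n - xbar] pairs [x n - xbar], which tends weakly
    to 0, with [W n (x n - xbar)], which converges strongly. *)
Lemma weak_to_strong (x : H^nat) (M : R) xbar z0 : 0 <= C ->
  (forall n, `|x n| <= M) -> weak_cvg dot x xbar ->
  cvgn (fun n => W n (x n - z0)) -> x @ \oo --> xbar.
Proof.
move=> C0 xM xw hc.
have key : dot (x n - xbar) (W n (x n - z0) - W n (xbar - z0)) @[n --> \oo] --> (0 : R).
  have := @weak_strong_cvg _ _ _ hdot _ \oo _ (fun n => x n - xbar)
    (fun n => W n (x n - z0) - W n (xbar - z0)) 0
    (limn (fun n => W n (x n - z0)) - limn (fun n => W n (xbar - z0))) (M + `|xbar|).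
  rewrite dot0l; apply.
  - by move=> n; apply: le_trans (ler_normB _ _) _; rewrite lerD2r.
  - move=> z; rewrite -(subrr xbar) dotDl dotNl.
    rewrite (_ : (fun n => _) = fun n => dot (x n) z - dot xbar z).
      by apply: cvgB; [exact: xw|exact: cvg_cst].
    by apply/funext => n; rewrite dotDl dotNl.
  - by apply: cvgB => //; exact: metric_cvg.
apply/cvgrPdist_le => e e0.
have ce : 0 < c * e ^+ 2 by rewrite mulr_gt0// exprn_gt0.
have /cvgr0Pnorm_le/(_ _ ce) := key; apply: filterS => n.
rewrite -(linearB (W n)) opprB addrA subrK dotC => /(le_trans (ler_norm _)) h.
rewrite -(ler_pXn2r (n := 2)) ?nnegrE ?(ltW e0)// distrC.
by rewrite -(ler_pM2l c_gt0) (le_trans (W_ge n _)).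
Qed.

(** Testing the quasi-Fejer inequality at [z0 - rho *: v], with [v] the unit
    vector along the increment of [W n (x n - z0)], bounds the norm of this
    increment by a telescoping term up to a summable error. *)
Lemma interior_metric_cvg (x : H^nat) (M : R) (zeta kappa nu : R^nat) z0 (rho : R) :
  0 <= C -> (forall n, `|x n| <= M) -> 0 < rho ->
  l1_plus zeta -> l1_plus kappa -> l1_plus nu ->
  (forall n y, dot (W n y) y <= (1 + nu n) * dot (W n.+1 y) y) ->
  (forall z, `|z - z0| <= rho -> forall n,
     dot (W n.+1 (x n.+1 - z)) (x n.+1 - z)
       <= (1 + zeta n) * dot (W n (x n - z)) (x n - z) + kappa n) ->
  cvgn (fun n => W n (x n - z0)).
Proof.
move=> C0 xM rho0 lz lk ln Wnu fejer.
pose h n := W n (x n - z0).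
pose u n := dot (h n) (x n - z0).
pose K := C * (M + `|z0| + rho) ^+ 2.
have K0 : 0 <= K by rewrite mulr_ge0// sqr_ge0.
pose delta n := (K * zeta n + kappa n) + rho ^+ 2 * C * nu n.
have ldelta : l1_plus delta.
  apply: l1_plusD; first by apply: l1_plusD => //; exact: l1_plusZ.
  by apply: l1_plusZ => //; rewrite mulr_ge0// sqr_ge0.
have aE k v : dot (W k (x k - (z0 - rho *: v))) (x k - (z0 - rho *: v)) =
    u k + 2 * rho * dot (h k) v + rho ^+ 2 * dot (W k v) v.
  have -> : x k - (z0 - rho *: v) = (x k - z0) + rho *: v.
    by rewrite opprB addrA addrAC.
  rewrite /u /h; move: (x k - z0) => p.
  by rewrite (linearD (W k)) (linearZ_LR (W k)) !dotE (metricC k v p); ring.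
have [_ lh] : cvgn u /\ l1_plus (fun n => 2 * rho * `|h n.+1 - h n|).
  apply: (almost_decreasing _ _ ldelta) => [n|n|n].
  - exact: metric_ge0.
  - by rewrite !mulr_ge0// ltW.
  (* If [g = 0], then [v = 0] because the inverse of 0 is 0. *)
  pose g := h n.+1 - h n; pose v := `|g|^-1 *: g.
  have v1 : `|v| <= 1.
    rewrite normrZ normfV normr_id; have [->|g0] := eqVneq g 0.
      by rewrite normr0 mulr0.
    by rewrite mulVf ?normr_eq0.
  have gv : dot g v = `|g|.
    rewrite dotZr hdot; have [->|g0] := eqVneq g 0; first by rewrite normr0 invr0 mul0r.
    by rewrite expr2 mulKf ?normr_eq0.
  pose z := z0 - rho *: v.
  have zz0 : `|z - z0| <= rho.
    rewrite /z addrAC subrr add0r normrN normrZ (gtr0_norm rho0).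
    by rewrite -[leRHS]mulr1 ler_pM2l.
  have aK : dot (W n (x n - z)) (x n - z) <= K.
    apply: le_trans (W_le _ _) _; rewrite ler_wpM2l// ler_pXn2r ?nnegrE//.
      apply: le_trans (ler_distD z0 _ _) _; rewrite (distrC z0); apply: lerD zz0.
      by apply: le_trans (ler_normB _ _) _; rewrite lerD2r.
    by have := le_trans (normr_ge0 _) (xM 0%N); have := normr_ge0 z0; lra.
  have := fejer z zz0 n; move: aK; rewrite !aE => aK hn.
  have Wv : dot (W n v) v - dot (W n.+1 v) v <= C * nu n.
    have WC : dot (W n.+1 v) v <= C.
      by apply: le_trans (W_le _ _) _; rewrite ler_piMr// expr_le1.
    have nu0 : 0 <= nu n by case: ln.
    by have := Wnu n v; have := ler_wpM2l nu0 WC; lra.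
  have z1 : 0 <= zeta n by case: lz.
  have : 2 * rho * `|h n.+1 - h n| = 2 * rho * dot (h n.+1) v - 2 * rho * dot (h n) v.
    by rewrite -/g -gv /g dotDl dotNl; ring.
  move=> ->; rewrite /delta.
  have : rho ^+ 2 * (dot (W n v) v - dot (W n.+1 v) v) <= rho ^+ 2 * (C * nu n).
    by rewrite ler_wpM2l// sqr_ge0.
  by move: (ler_wpM2l z1 aK) hn; lra.
have cs : cvgn (series (fun n => h n.+1 - h n)).
  apply: normed_cvg; have r0 : 0 <= (2 * rho)^-1 by rewrite invr_ge0 mulr_ge0// ltW.
  have [_] := l1_plusZ r0 lh.
  by under eq_fun do rewrite mulKf ?gt_eqF ?mulr_gt0//.
have -> : (fun n => W n (x n - z0)) = (fun n => series (fun n => h n.+1 - h n) n + h 0%N).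
  apply/funext => n; rewrite seriesEnat /= telescope_sumr//.
  by rewrite /h subrK.
by apply: is_cvgD => //; exact: is_cvg_cst.
Qed.

(** Since [zeta] and [kappa] do not depend on [z], a time at which [x n] is
    close to some point [z] of [Z] confines all later terms, hence also their weak
    limit, near this [z]. *)
Lemma fejer_strong (x : H^nat) (Z : set H) (zeta kappa : R^nat) xbar : 0 <= C ->
  l1_plus zeta -> l1_plus kappa ->
  (forall z, Z z -> forall n,
     dot (W n.+1 (x n.+1 - z)) (x n.+1 - z)
       <= (1 + zeta n) * dot (W n (x n - z)) (x n - z) + kappa n) ->
  weak_cvg dot x xbar ->
  (forall e, 0 < e -> forall N, exists2 n, (N <= n)%N & exists2 z, Z z & `|x n - z| < e) ->
  x @ \oo --> xbar.
Proof.
move=> C0 lz lk fejer xw near_Z; apply/cvgrPdist_le => e e0.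
have [S S0 zS] := l1_plus_ub lz.
have E0 := expR_gt0 S.
(* With [d <= 1], the bound of [gronwall_bound] at distance [d] is at most
   [expR S * ((C + 1) * d)]. *)
pose q := c * (e / 2) ^+ 2 / (expR S * (C + 1)).
have C1 : 0 < C + 1 by rewrite ltr_wpDl.
have q0 : 0 < q by rewrite divr_gt0// mulr_gt0// exprn_gt0// divr_gt0.
pose d := Num.min 1 q.
have d0 : 0 < d by rewrite lt_min ltr01.
have ck : series kappa @ \oo --> limn (series kappa) by case: lk.
have [N _ HN] : \forall n \near \oo, `|limn (series kappa) - series kappa n| < d.
  by move/cvgrPdist_lt : ck; exact.
have [n Nn [z Zz xz]] := near_Z d d0 N.
have close k : `|x (n + k)%N - z| <= e / 2.
  rewrite -(ler_pXn2r (n := 2)) ?nnegrE ?divr_ge0 ?(ltW e0)//.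
  rewrite -(ler_pM2l c_gt0); apply: le_trans (W_ge _ _) _.
  apply: le_trans (@gronwall_bound _ (fun n => dot (W n (x n - z)) (x n - z))
    zeta kappa S _ _ _ (fejer z Zz) zS n k) _.
  - by move=> m; exact: metric_ge0.
  - by case: lz.
  - by case: lk.
  have -> : c * (e / 2) ^+ 2 = expR S * ((C + 1) * q).
    by rewrite /q; field; rewrite !gt_eqF.
  rewrite ler_pM2l//.
  have dq : d <= q by rewrite ge_min lexx orbT.
  have d1 : d <= 1 by rewrite ge_min lexx.
  have kd : series kappa (n + k)%N - series kappa n <= d.
    have := HN n Nn; have : series kappa (n + k)%N <= limn (series kappa).
      apply: nondecreasing_cvgn_le; last by case: lk.
      by apply: nondecreasing_series => i _ _; case: lk.
    by move=> h1 /(le_lt_trans (ler_norm _)); lra.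
  have : C * `|x n - z| ^+ 2 <= C * d.
    by rewrite ler_wpM2l//; have := normr_ge0 (x n - z); nra.
  have := W_le n (x n - z); have : (C + 1) * d <= (C + 1) * q by rewrite ler_pM2l.
  lra.
have near_close : \forall m \near \oo, `|x m - z| <= e / 2.
  by exists n => // m /= nm; rewrite -(subnKC nm).
have lz' := weak_norm_le hdot xw near_close.
apply: filterS near_close => m h.
by apply: le_trans (ler_distD z _ _) _; rewrite (distrC z); lra.
Qed.

End VariableMetric.

(** * Operator norms and inverse metrics *)

Section OperatorNorm.
Context {R : realType} {H : completeNormedModType R}.
Variables (U : {linear H -> H}) (M : R).
Hypothesis U_bounded : forall x, `|U x| <= M * `|x|.

Let ball_image_has_sup : has_sup [set `|U x| | x in [set x | `|x| <= 1]].
Proof.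
split; first by exists `|U 0|, 0 => //=; rewrite normr0.
exists `|M| => _ [x /= x1 <-]; apply: le_trans (U_bounded x) _.
by have := ler_norm M; have := normr_ge0 x; have := normr_ge0 M; nra.
Qed.

Lemma opnorm_ge0 : 0 <= opnorm U.
Proof.
by apply: ub_le_sup; [case: ball_image_has_sup|exists 0; rewrite /= ?linear0 normr0].
Qed.

Lemma norm_le_opnorm x : `|U x| <= opnorm U * `|x|.
Proof.
have [->|x0] := eqVneq x 0; first by rewrite linear0 !normr0 mulr0.
have nx : 0 < `|x| by rewrite normr_gt0.
have : `|U (`|x|^-1 *: x)| <= opnorm U.
  apply: ub_le_sup; first by case: ball_image_has_sup.
  exists (`|x|^-1 *: x) => //=.
  by rewrite normrZ normfV normr_id mulVf ?gt_eqF.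
by rewrite linearZ normrZ normfV normr_id mulrC ler_pdivrMr.
Qed.

End OperatorNorm.

Section InverseMetric.
Context {R : realType} {H : completeNormedModType R}.
Variable dot : {dot H for (@idfun R)}.
Hypothesis hdot : hilbert_product dot.
Variables (U W : {linear H -> H}) (alpha mu : R).
Hypothesis alpha_gt0 : 0 < alpha.
Hypothesis U_sa : self_adjoint dot U.
Hypothesis U_ge : forall x, alpha * `|x| ^+ 2 <= dot (U x) x.
Hypothesis UW : forall y, U (W y) = y.

Lemma inverseK x : W (U x) = x.
Proof.
apply/eqP; rewrite -subr_eq0; apply/eqP/(coercive_eq0 alpha_gt0 U_ge).
by rewrite (linearB U) UW subrr dot0l.
Qed.

Lemma inverse_self_adjoint : self_adjoint dot W.
Proof. by move=> x y; rewrite -{1}(UW y) -U_sa UW. Qed.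

(** The left-hand side is maximal at [z = W y], where equality holds: this
    variational formula transfers quadratic bounds on [U] to bounds on [W]
    with the order reversed. *)
Lemma inverse_variational y z : 2 * dot y z - dot (U z) z <= dot (W y) y.
Proof.
have := coercive_ge0 alpha_gt0 U_ge (W y - z).
have UzWy : dot (U z) (W y) = dot y z by rewrite U_sa UW dotC.
by rewrite (linearB U) UW !dotE UzWy (dotC dot y (W y)); lra.
Qed.

Lemma inverse_le y : dot (W y) y <= alpha^-1 * `|y| ^+ 2.
Proof.
have := U_ge (W y); rewrite UW (dotC dot y) => h.
have := dot_le hdot (W y) y; rewrite ler_pdivlMl//.
move: h; set s := dot _ _; set t := `|W y|; set r := `|y| => h1 h2.
have t0 : 0 <= t := normr_ge0 _; have r0 : 0 <= r := normr_ge0 _.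
have atr : alpha * t <= r.
  have [->|tn0] := eqVneq t 0; first by rewrite mulr0.
  have tp : 0 < t by rewrite lt_neqAle eq_sym tn0.
  by rewrite -(ler_pM2r tp); lra.
have : alpha * s <= alpha * (t * r) by rewrite ler_pM2l.
by have := ler_wpM2r r0 atr; lra.
Qed.

Lemma inverse_ge : 0 < mu -> (forall x, dot (U x) x <= mu * `|x| ^+ 2) ->
  forall y, mu^-1 * `|y| ^+ 2 <= dot (W y) y.
Proof.
move=> mu0 U_le y; apply: le_trans (inverse_variational y (mu^-1 *: y)).
have := U_le (mu^-1 *: y); rewrite normrZ (gtr0_norm (_ : 0 < mu^-1)) ?invr_gt0//.
rewrite (dotZr dot _ y y) hdot exprMn.
have -> : mu * (mu^-1 ^+ 2 * `|y| ^+ 2) = mu^-1 * `|y| ^+ 2.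
  by field; rewrite gt_eqF.
lra.
Qed.

End InverseMetric.

Section InverseOrder.
Context {R : realType} {H : completeNormedModType R}.
Variable dot : {dot H for (@idfun R)}.
Variables (U W U' W' : {linear H -> H}) (alpha k : R).
Hypothesis alpha_gt0 : 0 < alpha.
Hypothesis U_sa : self_adjoint dot U.
Hypothesis U_ge : forall x, alpha * `|x| ^+ 2 <= dot (U x) x.
Hypothesis UW : forall y, U (W y) = y.
Hypothesis UW' : forall y, U' (W' y) = y.

Lemma inverse_antitone : 0 < k -> (forall x, dot (U x) x <= k * dot (U' x) x) ->
  forall y, dot (W' y) y <= k * dot (W y) y.
Proof.
move=> k0 UU' y.
(* This test vector is the maximizer in the variational formula for
   [k *: U']. *)
have := inverse_variational alpha_gt0 U_sa U_ge UW y (k^-1 *: W' y).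
have := UU' (W' y); rewrite UW' (linearZ_LR U) !dotE (dotC dot y (W' y)) => h1.
rewrite -(ler_pM2l k0); apply: le_trans.
have -> : k * (2 * (k^-1 * dot (W' y) y) - k^-1 * (k^-1 * dot (U (W' y)) (W' y)))
  = 2 * dot (W' y) y - k^-1 * dot (U (W' y)) (W' y).
  by field; rewrite gt_eqF.
have : k^-1 * dot (U (W' y)) (W' y) <= dot (W' y) y.
  by rewrite ler_pdivrMl// (dotC dot _ y) in h1 *.
lra.
Qed.

End InverseOrder.

(** * One step of the algorithm *)

Section OneStep.
Context {R : realType} {H : completeNormedModType R}.
Variable dot : {dot H for (@idfun R)}.
Hypothesis hdot : hilbert_product dot.
Variable W : {linear H -> H}.
Hypothesis W_sa : self_adjoint dot W.
Hypothesis W_ge0 : forall x, 0 <= dot (W x) x.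

Lemma metric_convex s t (l : R) : 0 <= l <= 1 ->
  dot (W ((1 - l) *: s + l *: t)) ((1 - l) *: s + l *: t)
    <= (1 - l) * dot (W s) s + l * dot (W t) t.
Proof.
move=> /andP[l0 l1]; have := W_ge0 (s - t).
have : 0 <= l * (1 - l) by rewrite mulr_ge0// subr_ge0.
rewrite !(linearZ_LR W, linearD W, linearN W) !dotE.
have -> : dot (W t) s = dot (W s) t by rewrite W_sa dotC.
nra.
Qed.

(** The cross term is split by Young's inequality with the weight [r] itself,
    so that summable perturbations yield summable corrections. *)
Lemma metric_perturb (C r : R) s e :
  (forall x, `|W x| ^+ 2 <= C * dot (W x) x) ->
  (forall x, dot (W x) x <= C * `|x| ^+ 2) -> 0 <= C -> `|e| <= r ->
  dot (W (s + e)) (s + e) <= (1 + C * r) * dot (W s) s + (r + C * r ^+ 2).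
Proof.
move=> W2 W_le C0 er.
rewrite (linearD W) !dotE; have -> : dot (W e) s = dot (W s) e by rewrite W_sa dotC.
have r0 := le_trans (normr_ge0 e) er.
have h1 : dot (W e) e <= C * r ^+ 2.
  by apply: le_trans (W_le e) _; rewrite ler_wpM2l// ler_pXn2r ?nnegrE.
have h2 : dot (W s) e <= `|W s| * r.
  by apply: le_trans (dot_le hdot _ _) _; rewrite ler_wpM2l.
have h3 : 2 * (`|W s| * r) <= r * (C * dot (W s) s + 1).
  have := W2 s; have := sqr_ge0 (`|W s| - 1) => h h'.
  have : 2 * `|W s| <= C * dot (W s) s + 1 by move: h h'; lra.
  by move=> /(ler_wpM2l r0); lra.
lra.
Qed.

(** In the applications [bx = B x], [bz = B z] and [q] is the resolvent of the
    forward step from [x], with [w] in [A q]. Expanding the form of [W] at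
    [x - z = (x - q) + (q - z)] and using the monotonicity between [q] and [z]
    leaves the cross term [2 * gam * dot d (q - z)]. Completing the square with
    [gam *: U d] replaces it by [2 * gam * dot d (x - z)] at the cost of
    [gam ^+ 2 * dot (U d) d], which cocoercivity pays since
    [gam * mu <= 2 * beta - eps]. *)
Lemma forward_backward_decrease (U : {linear H -> H}) x q z w bx bz
    (beta mu eps gam : R) :
  (forall y, W (U y) = y) ->
  dot (U (bx - bz)) (bx - bz) <= mu * `|bx - bz| ^+ 2 ->
  0 < gam -> gam * mu <= 2 * beta - eps ->
  beta * `|bx - bz| ^+ 2 <= dot (x - z) (bx - bz) ->
  0 <= dot (q - z) (w + bz) ->
  W (x - q) = gam *: (w + bx) ->
  dot (W (q - z)) (q - z) <= dot (W (x - z)) (x - z)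
    - (dot (W (x - q - gam *: U (bx - bz))) (x - q - gam *: U (bx - bz))
       + gam * eps * `|bx - bz| ^+ 2).
Proof.
move=> WU Ud g0 gmu coco mono Wxq.
set d := bx - bz in coco Ud *.
have E1 : dot (W (x - z)) (x - z) = dot (W (q - z)) (q - z)
    + 2 * dot (W (x - q)) (q - z) + dot (W (x - q)) (x - q).
  have -> : x - z = (x - q) + (q - z) by rewrite addrA subrK.
  move: (x - q) (q - z) => s t; rewrite (linearD W) !dotE.
  have -> : dot (W t) s = dot (W s) t by rewrite W_sa dotC.
  by ring.
have E2 s t : dot (W (s - gam *: U t)) (s - gam *: U t) =
    dot (W s) s - 2 * gam * dot t s + gam ^+ 2 * dot (U t) t.
  have WsUt : dot (W s) (U t) = dot t s by rewrite W_sa WU dotC.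
  by rewrite (linearB W) (linearZ_LR W) WU !dotE WsUt (dotC dot t (U t)); ring.
have E3 : dot (W (x - q)) (q - z) = gam * (dot (q - z) (w + bz) + dot d (q - z)).
  by rewrite Wxq dotZl /d !dotE (dotC dot q) !(dotC dot z) !(dotC dot q); ring.
have E4 : dot (x - z) d = dot d (x - q) + dot d (q - z).
  by rewrite -dotDr addrA subrK dotC.
have n0 : 0 <= `|d| ^+ 2 := sqr_ge0 _.
have h1 : gam ^+ 2 * dot (U d) d <= gam * (2 * beta - eps) * `|d| ^+ 2.
  have := ler_wpM2l (sqr_ge0 gam) Ud.
  by have := ler_wpM2l (ltW g0) (ler_wpM2r n0 gmu); rewrite -/d; lra.
have h2 : gam * (beta * `|d| ^+ 2) <= gam * dot (x - z) d by rewrite ler_pM2l.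
have h3 : 0 <= gam * dot (q - z) (w + bz) by rewrite mulr_ge0// ltW.
rewrite E1 E2 E3; move: h2; rewrite E4; lra.
Qed.

End OneStep.

(** * Vanishing sequences and distances to a set *)

Section Vanishing.
Context {R : realType} {H : completeNormedModType R}.
Implicit Types (f g : H^nat) (l : H).

Lemma cvg0_norm_le f g (K : R) :
  f @ \oo --> 0 -> (forall n, `|g n| <= K * `|f n|) -> g @ \oo --> 0.
Proof.
move=> f0 gf; apply: norm_cvg0.
apply: (@squeeze_cvgr _ _ _ _ (cst 0) (fun n => K * `|f n|)).
- by apply: nearW => n; rewrite /= normr_ge0 gf.
- exact: cvg_cst.
- by rewrite -(mulr0 K) -(@normr0 _ H); apply: cvgMl_tmp; exact: cvg_norm.
Qed.

Lemma cvg0_sqr_norm_le f (u : R^nat) (k : R) : 0 < k ->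
  (forall n, k * `|f n| ^+ 2 <= u n) -> u @ \oo --> (0 : R) -> f @ \oo --> 0.
Proof.
move=> k0 fu u0; apply/cvgr0Pnorm_le => e e0.
have ke : 0 < k * e ^+ 2 by rewrite mulr_gt0// exprn_gt0.
have /cvgr0Pnorm_le/(_ _ ke) := u0; apply: filterS => n /(le_trans (ler_norm _)) h.
by rewrite -(ler_pXn2r (n := 2)) ?nnegrE ?(ltW e0)// -(ler_pM2l k0) (le_trans (fu n)).
Qed.

Lemma cvg_of_subr_cvg0 f g l :
  g @ \oo --> l -> (f n - g n) @[n --> \oo] --> 0 -> f @ \oo --> l.
Proof.
move=> gl fg; rewrite -(add0r l) (_ : f = (fun n => f n - g n) \+ g).
  exact: cvgD.
by apply/funext => n /=; rewrite subrK.
Qed.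

Lemma limn_einf_dist0 (Z : set H) f : Z !=set0 ->
  limn_einf (fun n => (dist_to Z (f n))%:E) = 0%E ->
  forall e : R, 0 < e -> forall N, exists2 n, (N <= n)%N & exists2 z, Z z & `|f n - z| < e.
Proof.
move=> [z0 Zz0]; set u := (fun n => _ : \bar R) => u0 e e0 N.
have : (einfs u N < e%:E)%E.
  apply: (@le_lt_trans _ _ 0%E); last by rewrite lte_fin.
  rewrite -u0 limn_einf_lim (cvg_lim _ (@cvg_einfs_sup _ u))//.
  by apply: ereal_sup_ubound; exists N.
move=> /ereal_inf_lt[_ [n /= Nn <-]]; rewrite lte_fin => /inf_lt.
case; first by exists `|f n - z0|, z0.
by move=> _ [z Zz <-] fz; exists n => //; exists z.
Qed.

End Vanishing.

(** * The perturbed forward-backward algorithm *)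

Section ForwardBackward.
Context {R : realType} {H : completeNormedModType R}.
Variable dot : {dot H for (@idfun R)}.
Hypothesis hdot : hilbert_product dot.
Variables (A : H -> set H) (B : H -> H) (beta alpha mu eps : R).
Variables (U W : nat -> {linear H -> H}) (eta lambda gamma : R^nat).
Variables (a b x p q v w : H^nat).
Hypothesis hA : maximally_monotone dot A.
Hypothesis beta_gt0 : 0 < beta.
Hypothesis hB : cocoercive dot beta B.
Hypothesis alpha_gt0 : 0 < alpha.
Hypothesis mu_gt0 : 0 < mu.
Hypothesis eps_gt0 : 0 < eps.
Hypothesis eta_l1 : l1_plus eta.
Hypothesis U_sa : forall n, self_adjoint dot (U n).
Hypothesis U_ge : forall n y, alpha * `|y| ^+ 2 <= dot (U n y) y.
Hypothesis U_norm : forall n y, `|U n y| <= mu * `|y|.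
Hypothesis U_mon : forall n y, dot (U n y) y <= (1 + eta n) * dot (U n.+1 y) y.
Hypothesis UW : forall n y, U n (W n y) = y.
Hypothesis lambda_bound : forall n, eps <= lambda n <= 1.
Hypothesis gamma_ge : forall n, eps <= gamma n.
Hypothesis gamma_le : forall n, gamma n * mu <= 2 * beta - eps.
Hypothesis a_l1 : l1_plus (fun n => `|a n|).
Hypothesis b_l1 : l1_plus (fun n => `|b n|).
(** [p n] is the computed resolvent, at the perturbed forward point; [q n] is
    the resolvent at the unperturbed one. *)
Hypothesis Apv : forall n, A (p n) (v n).
Hypothesis p_eq : forall n,
  p n + gamma n *: U n (v n) = x n - gamma n *: U n (B (x n) + b n).
Hypothesis Aqw : forall n, A (q n) (w n).
Hypothesis q_eq : forall n,
  q n + gamma n *: U n (w n) = x n - gamma n *: U n (B (x n)).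
Hypothesis x_eq : forall n, x n.+1 = x n + lambda n *: (p n + a n - x n).

Let gamma_gt0 n : 0 < gamma n. Proof. exact: lt_le_trans (gamma_ge n). Qed.

Let eta_ge0 n : 0 <= eta n. Proof. by case: eta_l1. Qed.

Let WU n y : W n (U n y) = y.
Proof. exact: (inverseK alpha_gt0 (U_ge n) (UW n)). Qed.

Let W_sa n : self_adjoint dot (W n).
Proof. exact: (inverse_self_adjoint (U_sa n) (UW n)). Qed.

Let U_le n y : dot (U n y) y <= mu * `|y| ^+ 2.
Proof.
apply: le_trans (dot_le hdot _ _) _.
by have := ler_wpM2r (normr_ge0 y) (U_norm n y); rewrite expr2 mulrA.
Qed.

Let W_ge n y : mu^-1 * `|y| ^+ 2 <= dot (W n y) y.
Proof. exact: (inverse_ge hdot alpha_gt0 (U_sa n) (U_ge n) (UW n) mu_gt0 (U_le n)). Qed.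

Let W_le n y : dot (W n y) y <= alpha^-1 * `|y| ^+ 2.
Proof. exact: (inverse_le hdot alpha_gt0 (U_ge n) (UW n)). Qed.

Let W_mon n y : dot (W n.+1 y) y <= (1 + eta n) * dot (W n y) y.
Proof.
apply: (inverse_antitone alpha_gt0 (U_sa n) (U_ge n) (UW n) (UW n.+1) _ (U_mon n)).
by rewrite ltr_wpDr.
Qed.

Let C_ge0 : 0 <= alpha^-1. Proof. by rewrite invr_ge0 ltW. Qed.

Let mui_gt0 : 0 < mu^-1. Proof. by rewrite invr_gt0. Qed.

Let W_ge0 n y : 0 <= dot (W n y) y.
Proof. exact: (metric_ge0 mui_gt0 W_ge). Qed.

Let gamma_mu n : gamma n * mu <= 2 * beta.
Proof. by apply: le_trans (gamma_le n) _; rewrite gerBl ltW. Qed.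

(** Monotonicity of [A] makes the resolvent nonexpansive for the metric [W n],
    and [W n] sends the perturbation [gamma n *: U n (b n)] of its argument to
    [gamma n *: b n]. *)
Lemma resolvent_error n : `|p n - q n| <= 2 * beta * `|b n|.
Proof.
have E : W n (p n - q n) = - (gamma n *: (b n + (v n - w n))).
  rewrite -[b n + _](WU n) -(linearZ_LR (W n)) -(linearN (W n)); congr (W n _).
  have -> : p n = x n - gamma n *: U n (B (x n) + b n) - gamma n *: U n (v n).
    by rewrite -p_eq addrK.
  have -> : q n = x n - gamma n *: U n (B (x n)) - gamma n *: U n (w n).
    by rewrite -q_eq addrK.
  rewrite !(linearD (U n), linearN (U n)) !(scalerDr, scalerN).
  set s := gamma n *: U n (B (x n)); set t := gamma n *: U n (b n).
  set e := gamma n *: U n (v n); set f := gamma n *: U n (w n).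
  rewrite [- (s + t)]opprD [x n + (- s - t)]addrA; move: (x n - s) => y.
  rewrite opprB [LHS]addrC -[y - t - e]addrA addrA subrK [- (t + _)]opprD opprB.
  by rewrite addrCA.
have mono : 0 <= dot (p n - q n) (v n - w n) by apply: (proj1 hA); [exact: Apv|exact: Aqw].
have h1 := W_ge n (p n - q n).
have h2 : dot (W n (p n - q n)) (p n - q n) <= gamma n * (`|b n| * `|p n - q n|).
  rewrite E dotNl dotZl dotDl (dotC dot (v n - w n)) -mulrN.
  rewrite ler_pM2l//; have := dot_le hdot (- b n) (p n - q n).
  by rewrite normrN dotNl; lra.
have := normr_ge0 (p n - q n); rewrite le_eqVlt => /predU1P[<-|d0].
  by rewrite !mulr_ge0// ltW.
have := le_trans h1 h2; rewrite ler_pdivrMl// => h3.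
have : `|p n - q n| <= mu * gamma n * `|b n|.
  by rewrite -(ler_pM2r d0); lra.
move=> /le_trans; apply; rewrite ler_wpM2r// mulrC; exact: gamma_mu.
Qed.

Lemma resolvent_metric n : W n (x n - q n) = gamma n *: (w n + B (x n)).
Proof.
rewrite -[w n + _](WU n) -(linearZ_LR (W n)); congr (W n _).
rewrite (linearD (U n)) scalerDr.
apply/eqP; rewrite subr_eq addrAC -subr_eq; apply/eqP.
by rewrite -q_eq addrC.
Qed.

(** As [eps] and [eps ^+ 2] bound [lambda n] and [gamma n * eps] from below,
    this is a lower bound for the gain of the relaxed step. *)
Definition decrease z n :=
  eps * (dot (W n (x n - q n - gamma n *: U n (B (x n) - B z)))
             (x n - q n - gamma n *: U n (B (x n) - B z))
         + eps ^+ 2 * `|B (x n) - B z| ^+ 2).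

Lemma decrease_ge0 z n : 0 <= decrease z n.
Proof.
by rewrite /decrease mulr_ge0 ?(ltW eps_gt0)// addr_ge0// mulr_ge0// sqr_ge0.
Qed.

(** The sequences [zeta] and [kappa] are chosen before [z]: this uniformity is
    what [fejer_strong] and [interior_metric_cvg] rely on. Since [eta] and the size
    [r] of the errors are bounded by [E] and [rho], their products and squares
    are dominated by [r]. *)
Lemma fejer_inequality : exists zeta kappa : R^nat,
  [/\ l1_plus zeta, l1_plus kappa &
      forall z, A z (- B z) -> forall n,
        dot (W n.+1 (x n.+1 - z)) (x n.+1 - z) + decrease z n
          <= (1 + zeta n) * dot (W n (x n - z)) (x n - z) + kappa n].
Proof.
pose C := alpha^-1.
pose r n := `|a n| + 2 * beta * `|b n|.
have lr : l1_plus r.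
  by apply: l1_plusD => //; apply: l1_plusZ => //; rewrite mulr_ge0// ltW.
have r0 n : 0 <= r n by case: lr.
have [E E0 etaE] := l1_plus_term_ub eta_l1.
have [rho rho0 rrho] := l1_plus_term_ub lr.
exists (fun n => eta n + (1 + E) * C * r n), (fun n => (1 + E) * (1 + C * rho) * r n).
split.
- apply: l1_plusD => //; apply: l1_plusZ => //.
  by rewrite mulr_ge0 ?addr_ge0.
- by apply: l1_plusZ => //; rewrite mulr_ge0 ?addr_ge0 ?mulr_ge0.
move=> z Az n.
have /andP[le l1] := lambda_bound n.
have l0 : 0 <= lambda n by rewrite (le_trans _ le)// ltW.
set Qx := dot (W n (x n - z)) (x n - z).
pose s := (1 - lambda n) *: (x n - z) + lambda n *: (q n - z).
pose e := lambda n *: (a n + (p n - q n)).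
have xE : x n.+1 - z = s + e.
  rewrite x_eq addrAC /s /e scalerBl scale1r -[RHS]addrA -[RHS]addrA.
  congr (_ + _); rewrite -scalerN -!scalerDr; congr (_ *: _).
  rewrite opprB [RHS]addrA [z - x n + _]addrC [_ + (z - x n)]addrA subrK [RHS]addrC.
  by rewrite addrA addrA subrK [p n + _]addrC.
have er : `|e| <= r n.
  rewrite normrZ ger0_norm//; apply: (@le_trans _ _ (`|a n + (p n - q n)|)).
    by rewrite ler_piMl.
  by apply: le_trans (ler_normD _ _) _; rewrite lerD2l; exact: resolvent_error.
have mono : 0 <= dot (q n - z) (w n + B z).
  by have := (proj1 hA) _ _ _ _ (Aqw n) Az; rewrite opprK.
have step := forward_backward_decrease (W_sa n) (WU n) (U_le n _) (gamma_gt0 n)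
  (gamma_le n) (hB _ _) mono (resolvent_metric n).
set D := dot (W n (x n - q n - _)) _ in step.
have D0 : 0 <= D by exact: W_ge0.
set d2 := `|B (x n) - B z| ^+ 2 in step.
have d0 : 0 <= d2 by exact: sqr_ge0.
have decE : decrease z n <= lambda n * (D + gamma n * eps * d2).
  rewrite /decrease -/D -/d2.
  have ge2 : eps ^+ 2 * d2 <= gamma n * eps * d2.
    by rewrite ler_wpM2r// expr2 ler_pM2r.
  apply: ler_pM => //; rewrite ?(ltW eps_gt0) ?lerD2l//.
  by rewrite addr_ge0// mulr_ge0// sqr_ge0.
have Qs : dot (W n s) s <= Qx - decrease z n.
  have l01 : 0 <= lambda n <= 1 by rewrite l0.
  apply: le_trans (metric_convex (W_sa n) (W_ge0 n) _ _ l01) _; rewrite -/Qx.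
  by have := ler_wpM2l l0 step; rewrite -/Qx; lra.
have Qs0 : 0 <= dot (W n s) s := W_ge0 n s.
have dec0 := decrease_ge0 z n.
have W2 y := metric_sqr_norm hdot W_sa mui_gt0 W_ge W_le n y.
have Qe := metric_perturb hdot (W_sa n) s W2 (W_le n) C_ge0 er.
rewrite -/C -xE in Qe.
have C0 : 0 <= C := C_ge0.
have h1 : dot (W n (x n.+1 - z)) (x n.+1 - z) + decrease z n <=
    (1 + C * r n) * Qx + (1 + C * rho) * r n.
  have Crn : 0 <= C * r n by rewrite mulr_ge0.
  have : C * r n ^+ 2 <= C * rho * r n.
    by rewrite -mulrA ler_wpM2l// expr2 ler_wpM2r.
  have := ler_wpM2l Crn Qs; have := mulr_ge0 Crn dec0; lra.
have Qx0 : 0 <= Qx := W_ge0 n _.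
have h2 := W_mon n (x n.+1 - z).
have e0 := eta_ge0 n.
set Q1 := dot (W n (x n.+1 - z)) _ in h1 h2.
have h3 := ler_wpM2l e0 h1.
have h4 : eta n * ((1 + C * rho) * r n) <= E * ((1 + C * rho) * r n).
  by rewrite ler_wpM2r// mulr_ge0// addr_ge0// mulr_ge0.
have h5 : eta n * (C * r n * Qx) <= E * (C * r n * Qx).
  by rewrite ler_wpM2r// !mulr_ge0.
have := mulr_ge0 e0 dec0; lra.
Qed.

Section Trajectory.
Variables (Z : set H) (zeta kappa : R^nat).
Hypothesis ZE : forall z, Z z <-> A z (- B z).
Hypothesis zeta_l1 : l1_plus zeta.
Hypothesis kappa_l1 : l1_plus kappa.
Hypothesis fejer : forall z, Z z -> forall n,
  dot (W n.+1 (x n.+1 - z)) (x n.+1 - z) + decrease z n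
    <= (1 + zeta n) * dot (W n (x n - z)) (x n - z) + kappa n.

Lemma trajectory_distance z : Z z ->
  cvgn (fun n => dot (W n (x n - z)) (x n - z)) /\ l1_plus (decrease z).
Proof.
move=> Zz; apply: (quasi_fejer_seq _ _ zeta_l1 kappa_l1 (fejer Zz)) => n.
- exact: W_ge0.
- exact: decrease_ge0.
Qed.

Lemma trajectory_bounded z : Z z -> exists M, forall n, `|x n| <= M.
Proof.
move=> Zz; have [/cvg_seq_bounded[M [_ xM]] _] := trajectory_distance Zz.
exists (mu * (M + 1) + 1 + `|z|) => n.
have M1 : M < M + 1 by rewrite ltrDl.
have h := le_trans (ler_norm _) (xM _ M1 n I).
have := le_trans (W_ge n (x n - z)) h; rewrite ler_pdivrMl// => h'.
have := ler_distD z (x n) 0; rewrite !subr0; have := sqr_ge0 (`|x n - z| - 1); nra.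
Qed.

Lemma forward_summable z : Z z -> l1_plus (fun n => `|B (x n) - B z| ^+ 2).
Proof.
move=> Zz; have [_ ld] := trajectory_distance Zz.
have e3 : 0 < eps * eps ^+ 2 by rewrite mulr_gt0// exprn_gt0.
apply: (l1_plus_le (v := fun n => (eps * eps ^+ 2)^-1 * decrease z n)).
  move=> n; rewrite sqr_ge0/= ler_pdivlMl// /decrease -mulrA ler_pM2l// lerDr.
  exact: W_ge0.
by apply: l1_plusZ => //; rewrite invr_ge0 ltW.
Qed.

Lemma forward_vanish z : Z z -> (B (x n) - B z) @[n --> \oo] --> 0.
Proof.
move=> Zz; have [_ /cvg_series_cvg_0 h] := forward_summable Zz.
by apply: (cvg0_sqr_norm_le (k := 1) _ _ h) => // n; rewrite mul1r.
Qed.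

Lemma forward_cvg z : Z z -> B (x n) @[n --> \oo] --> B z.
Proof.
by move=> Zz; apply: (cvg_of_subr_cvg0 _ (forward_vanish Zz)); exact: cvg_cst.
Qed.

Lemma resolvent_vanish z : Z z -> (x n - q n) @[n --> \oo] --> 0.
Proof.
move=> Zz; have [_ [_ /cvg_series_cvg_0 h]] := trajectory_distance Zz.
have g0 : (gamma n *: U n (B (x n) - B z)) @[n --> \oo] --> 0.
  apply: (cvg0_norm_le (K := 2 * beta) (forward_vanish Zz)) => n.
  rewrite normrZ (gtr0_norm (gamma_gt0 n)).
  apply: (@le_trans _ _ (gamma n * (mu * `|B (x n) - B z|))).
    by rewrite ler_pM2l.
  by rewrite mulrA ler_wpM2r.
apply: (cvg_of_subr_cvg0 g0); apply: (cvg0_sqr_norm_le (k := eps * mu^-1) _ _ h).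
  by rewrite mulr_gt0.
move=> n; rewrite /decrease -mulrA ler_pM2l//.
by apply: le_trans (W_ge n _) _; rewrite lerDl mulr_ge0// sqr_ge0.
Qed.

Lemma dual_cvg z : Z z -> w @ \oo --> - B z.
Proof.
move=> Zz.
have wE n : w n = (gamma n)^-1 *: W n (x n - q n) - B (x n).
  by rewrite resolvent_metric scalerA mulVf ?gt_eqF// scale1r addrK.
rewrite (_ : w = fun n => (gamma n)^-1 *: W n (x n - q n) - B (x n)); last first.
  exact/funext.
rewrite -[- B z]add0r; apply: cvgB; last exact: forward_cvg.
apply: (cvg0_norm_le (K := eps^-1 * alpha^-1) (resolvent_vanish Zz)) => n.
rewrite normrZ gtr0_norm ?invr_gt0// -mulrA; apply: ler_pM => //.
- by rewrite invr_ge0 ltW.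
- by rewrite lef_pV2 ?posrE.
- exact: (metric_norm hdot W_sa mui_gt0 W_ge W_le C_ge0).
Qed.

(** Demiclosedness: along the ultrafilter the dual points [w n] of the graph of
    [A] converge strongly, which lets the monotonicity inequalities pass to the
    limit, and maximality of [A] identifies the limit. *)
Lemma weak_cluster_zero z F l : Z z -> UltraFilter F -> \oo `<=` F ->
  weak_cvg_along dot F x l -> Z l.
Proof.
move=> Zz UF sF xl.
have [M xM] := trajectory_bounded Zz.
have alongF (V : topologicalType) (f : nat -> V) (m : V) : f @ \oo --> m -> f @ F --> m.
  by move=> fm P mP; apply: sF; exact: fm.
have ql : weak_cvg_along dot F q l.
  by apply: (weak_cvg_alongB hdot xl); exact: alongF (resolvent_vanish Zz).
have [K qK] : exists K, forall n, `|q n| <= K.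
  have cxq : cvgn (fun n => x n - q n).
    by apply/cvg_ex; exists 0; exact: resolvent_vanish Zz.
  have [K [_ hK]] := cvg_seq_bounded cxq.
  exists (M + (K + 1)) => n.
  have K1 : K < K + 1 by rewrite ltrDl.
  have h := hK _ K1 n I.
  rewrite (_ : q n = x n - (x n - q n)); last by rewrite opprB addrC subrK.
  by apply: le_trans (ler_normB _ _) _; exact: lerD.
have Al : A l (- B z).
  apply: (maximally_monotone_mem hA) => p' v' Ap'.
  have lim : dot (q n - p') (w n - v') @[n --> F] --> dot (l - p') (- B z - v').
    apply: (@weak_strong_cvg _ _ _ hdot _ F _ _ _ _ _ (K + `|p'|)).
    - by move=> n; apply: le_trans (ler_normB _ _) _; rewrite lerD2r.
    - exact: weak_cvg_along_subr.
    - by apply: cvgB; [exact: alongF (dual_cvg Zz)|exact: cvg_cst].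
  have : 0 <= dot (l - p') (- B z - v').
    apply: (@ler_cvg_to _ F _ _ (cst 0) (fun n => dot (q n - p') (w n - v'))).
    - exact: cvg_cst.
    - exact: lim.
    - by apply: nearW => n; exact: (proj1 hA _ _ _ _ (Aqw n) Ap').
  by rewrite -opprB -[- B z - v']opprB dotNl dotNr opprK.
have Bl : B l = B z.
  have lim : dot (x n - l) (B (x n) - B l) @[n --> F] --> dot (l - l) (B z - B l).
    apply: (@weak_strong_cvg _ _ _ hdot _ F _ _ _ _ _ (M + `|l|)).
    - by move=> n; apply: le_trans (ler_normB _ _) _; rewrite lerD2r.
    - exact: weak_cvg_along_subr.
    - by apply: cvgB; [exact: alongF (forward_cvg Zz)|exact: cvg_cst].
  have : beta * dot (B z - B l) (B z - B l) <= dot (l - l) (B z - B l).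
    apply: (@ler_cvg_to _ F _ _ (fun n => beta * dot (B (x n) - B l) (B (x n) - B l))
      (fun n => dot (x n - l) (B (x n) - B l))).
    - apply: alongF; apply: cvgMl_tmp; apply: (dot_cvg hdot).
        by apply: cvgB; [exact: forward_cvg|exact: cvg_cst].
      by apply: cvgB; [exact: forward_cvg|exact: cvg_cst].
    - exact: lim.
    - by apply: nearW => n; rewrite hdot; exact: hB.
  rewrite subrr dot0l pmulr_rle0// hdot => h.
  apply/esym/eqP; rewrite -subr_eq0 -normr_eq0 -sqrf_eq0 eq_le h; exact: sqr_ge0.
by apply/ZE; rewrite Bl.
Qed.

Lemma strong_of_demiregular xbar : Z xbar -> weak_cvg dot x xbar ->
  demiregular dot A xbar \/ demiregular dot (op_fun B) xbar -> x @ \oo --> xbar.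
Proof.
move=> Zx xw [[_ dA]|[_ dB]].
- have qx : q @ \oo --> xbar.
    apply: (dA q w (- B xbar)) => //.
    + exact/ZE.
    + exact: (weak_cvg_alongB hdot xw (resolvent_vanish Zx)).
    + exact: dual_cvg.
  exact: cvg_of_subr_cvg0 qx (resolvent_vanish Zx).
- by apply: (dB x (B \o x) (B xbar)) => //; exact: forward_cvg.
Qed.

Lemma strong_of_interior xbar (nu : R^nat) : Z xbar -> weak_cvg dot x xbar ->
  Z° !=set0 -> l1_plus nu ->
  (forall n y, dot (U n.+1 y) y <= (1 + nu n) * dot (U n y) y) -> x @ \oo --> xbar.
Proof.
move=> Zx xw [z0 /nbhs_ballP[rho /= rho0 ballZ]] lnu nuU.
have [M xM] := trajectory_bounded Zx.
apply: (weak_to_strong hdot W_sa mui_gt0 W_ge W_le eta_l1 W_mon C_ge0 xM xw (z0 := z0)).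
apply: (interior_metric_cvg hdot W_sa mui_gt0 W_ge W_le C_ge0 xM
  (_ : 0 < rho / 2) zeta_l1 kappa_l1 lnu).
- by rewrite divr_gt0.
- move=> n y; have nu0 : 0 <= nu n by case: lnu.
  apply: (inverse_antitone alpha_gt0 (U_sa n.+1) (U_ge n.+1) (UW n.+1) (UW n) _ (nuU n)).
  by rewrite ltr_wpDr.
- move=> z zz0 n; have Zz : Z z.
    apply: ballZ; rewrite -ball_normE /= distrC; apply: le_lt_trans zz0 _.
    by rewrite ltr_pdivrMr// ltr_pMr// ltr1n.
  by have := fejer Zz n; have := decrease_ge0 z n; lra.
Qed.

End Trajectory.

Lemma forward_backward_convergence (Z : set H) :
  (forall z, Z z <-> A z (- B z)) -> Z !=set0 ->
  exists2 xbar : H, Z xbar &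
    [/\ weak_cvg dot x xbar,
        cvgn (series (fun n => `|B (x n) - B xbar| ^+ 2)) &
        [\/ limn_einf (fun n => (dist_to Z (x n))%:E) = 0%E,
            forall z, Z z -> demiregular dot A z \/ demiregular dot (op_fun B) z
          | Z° !=set0 /\
            exists2 nu : R^nat, l1_plus nu &
              forall n, loewner_ge dot (fun x => (1 + nu n) *: U n x) (U n.+1)] ->
        x @ \oo --> xbar].
Proof.
move=> ZE Z0; have [z0 Zz0] := Z0.
have [zeta [kappa [lz lk fej]]] := fejer_inequality.
have fejer z : Z z -> forall n,
    dot (W n.+1 (x n.+1 - z)) (x n.+1 - z) + decrease z n
      <= (1 + zeta n) * dot (W n (x n - z)) (x n - z) + kappa n.
  by move/ZE; exact: fej.
have [M xM] := trajectory_bounded lz lk fejer Zz0.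
have [xbar Zx xw] : exists2 l, Z l & weak_cvg dot x l.
  apply: (opial hdot W_sa mui_gt0 W_ge W_le eta_l1 W_mon C_ge0 xM).
    by move=> z Zz; have [] := trajectory_distance lz lk fejer Zz.
  by move=> F l UF sF xl; exact: (weak_cluster_zero ZE lz lk fejer Zz0 UF sF xl).
exists xbar => //; split => //.
  by have [] := forward_summable lz lk fejer Zx.
case.
- move=> /(limn_einf_dist0 Z0) near_Z.
  apply: (fejer_strong hdot mui_gt0 W_ge W_le C_ge0 lz lk _ xw near_Z) => z Zz n.
  by have := fejer z Zz n; have := decrease_ge0 z n; lra.
- by move=> demi; exact: (strong_of_demiregular ZE lz lk fejer Zx xw (demi _ Zx)).
- move=> [intZ [nu lnu nuU]].
  apply: (strong_of_interior lz lk fejer Zx xw intZ lnu) => n y.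
  by have := nuU n y; rewrite /= dotZl.
Qed.

End ForwardBackward.
Theorem theorem4p1 (R : realType) (H : completeNormedModType R)
  (dot : {dot H for (@idfun R)}) (hdot : hilbert_product dot)
  (A : H -> set H) (hA : maximally_monotone dot A)
  (alpha : R) (halpha : 0 < alpha)
  (beta : R) (hbeta : 0 < beta)
  (B : H -> H) (hB : cocoercive dot beta B)
  (eta : R^nat) (heta : l1_plus eta)
  (U : nat -> {linear H -> H}) (hU : forall n, P_ dot alpha (U n))
  (mu : R)
  (hUbnd : has_ubound (range (fun n => opnorm (U n))))
  (hmu : mu = sup (range (fun n => opnorm (U n))))
  (hUmon : forall n,
     loewner_ge dot (fun x => (1 + eta n) *: U n.+1 x) (U n))
  (eps : R)
  (heps : 0 < eps <= Num.min 1 (2 * beta / (mu + 1)))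
  (lambda : R^nat) (hlambda : forall n, eps <= lambda n <= 1)
  (gamma : R^nat)
  (hgamma : forall n, eps <= gamma n <= (2 * beta - eps) / mu)
  (x0 : H)
  (a b : H^nat) (ha : absolutely_summable a) (hb : absolutely_summable b)
  (Z : set H) (hZ : Z = zer (op_add A (op_fun B))) (hZ0 : Z !=set0)
  (x y : H^nat) (hx0 : x 0%N = x0)
  (hy : forall n, y n = x n - gamma n *: U n (B (x n) + b n))
  (hx : forall n,
     x n.+1 = x n + lambda n *:
       (J (op_comp (fun u => gamma n *: U n u) A) (y n) + a n - x n)) :
  exists2 xbar : H, Z xbar &
    [/\ weak_cvg dot x xbar,
        cvgn (series (fun n => `|B (x n) - B xbar| ^+ 2)) &
        [\/ limn_einf (fun n => (dist_to Z (x n))%:E) = 0%E,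
            forall z, Z z -> demiregular dot A z \/ demiregular dot (op_fun B) z
          | Z° !=set0 /\
            exists2 nu : R^nat, l1_plus nu &
              forall n, loewner_ge dot (fun x => (1 + nu n) *: U n x) (U n.+1)] ->
        x @ \oo --> xbar].
Proof.
have U_bounded n := let: And3 h _ _ := hU n in h.
have U_sa n : self_adjoint dot (U n) by case: (hU n).
have U_ge n z : alpha * `|z| ^+ 2 <= dot (U n z) z.
  by have [_ _ h] := hU n; have := h z; rewrite /= dotZl hdot.
have opU n : opnorm (U n) <= mu by rewrite hmu; apply: ub_le_sup => //; exists n.
have mu_ge0 : 0 <= mu.
  by have [M h] := U_bounded 0%N; exact: le_trans (opnorm_ge0 h) (opU 0%N).
have U_norm n z : `|U n z| <= mu * `|z|.
  have [M h] := U_bounded n; apply: le_trans (norm_le_opnorm h z) _.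
  by rewrite ler_wpM2r.
have /andP[eps_gt0 _] := heps.
(* On the trivial space every operator norm vanishes; the bounds on the step
   sizes are then inconsistent, because division by zero gives zero. *)
have mu_gt0 : 0 < mu.
  rewrite lt_neqAle mu_ge0 andbT; apply/eqP => mu0.
  have /andP[h1 h2] := hgamma 0%N.
  by have := le_trans h1 h2; rewrite -mu0 invr0 mulr0 leNgt eps_gt0.
have gamma_ge n : eps <= gamma n by case/andP: (hgamma n).
have gamma_le n : gamma n * mu <= 2 * beta - eps.
  by rewrite -ler_pdivlMr//; case/andP: (hgamma n).
have U_mon n z : dot (U n z) z <= (1 + eta n) * dot (U n.+1 z) z.
  by have := hUmon n z; rewrite /= dotZl.
have /choice[W UW] n : exists W : {linear H -> H}, forall z, U n (W z) = z.
  have [M h] := U_bounded n.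
  exact: (coercive_inverse hdot h (U_sa n) halpha (U_ge n)).
have gamma_gt0 n : 0 < gamma n := lt_le_trans eps_gt0 (gamma_ge n).
have resolvent_exists n z :
    exists pv : H * H, A pv.1 pv.2 /\ pv.1 + gamma n *: U n pv.2 = z.
  pose T : {linear H -> H} := gamma n \*: U n.
  have T_sa : self_adjoint dot T by move=> s t; rewrite /T /= dotZl dotZr U_sa.
  have T_ge s : gamma n * alpha * `|s| ^+ 2 <= dot (T s) s.
    by rewrite /T /= dotZl -mulrA ler_pM2l.
  have T_bd s : `|T s| <= gamma n * mu * `|s|.
    by rewrite /T /= normrZ gtr0_norm// -mulrA ler_pM2l.
  have tau0 : 0 < gamma n * alpha by rewrite mulr_gt0.
  have [s [t [Ast st]]] := minty hdot T_bd T_sa tau0 T_ge z hA.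
  by exists (s, t).
pose JA n := J (op_comp (fun u => gamma n *: U n u) A).
have /choice[v vP] n : exists v, A (JA n (y n)) v /\ JA n (y n) + gamma n *: U n v = y n.
  have : resolvent (op_comp (fun u => gamma n *: U n u) A) (y n) (JA n (y n)).
    have [[s t] /= [Ast st]] := resolvent_exists n (y n).
    rewrite /JA /J; apply: xgetPex; exists s.
    by exists s => //; exists (gamma n *: U n t) => //; exists t.
  by move=> [_ -> [_ [u Au <-] e]]; exists u.
have /choice[qw qwP] n := resolvent_exists n (x n - gamma n *: U n (B (x n))).
apply: (@forward_backward_convergence _ _ dot hdot A B beta alpha mu eps U W eta
  lambda gamma a b x (fun n => JA n (y n)) (fst \o qw) v (snd \o qw)) => //.
- by move=> n; case: (vP n).
- by move=> n; rewrite -hy; case: (vP n).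
- by move=> n; case: (qwP n).
- by move=> n; case: (qwP n).
move=> z; rewrite hZ; split.
  by move=> [u Au [_ -> e]]; rewrite (addr0_eq (etrans (addrC _ _) e)).
by move=> Az; exists (- B z) => //; exists (B z) => //; rewrite addNr.
Qed.
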